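(* Let $d\ge3$ and let $\mathcal{F}$ be a collection of functions from $\mathbb{Z}^d$ to $\mathbb{R}^+$. For any $\kappa\ge1$, for $n$ large enough, $$E\big(e^{-|R_N|};f_N\in\mathcal{F}\big)\le\exp(-\kappa n^d)+\exp\Bigg(n^{d-1/8}-\inf\Big\{\big|\{x\in\mathbb{Z}^d:h(x)>0\}\big|+\frac N2(1-n^{-1/4})\Big(\max\Big(\sqrt{\mathcal{E}(\sqrt h)}-\frac{1}{n^{9/8}},0\Big)\Big)^2\Big\}\Bigg),$$ where the infimum is over all $h\in\ell^1(\mathbb{Z}^d)$ with $h\ge0$ such that there exists $f\in\mathcal{F}$ with $\big\|h-\frac1N f^2\big\|_1\le n^{-1/16}$.
   Context: $(S_k)$ is the simple random walk on $\mathbb{Z}^d$ from the origin with law $P$; $E(X;\mathcal{A})=E(X1_\mathcal{A})$. $N=n^{d+2}$ with $n$ a positive integer. $R_N$ is the set of sites visited up to time $N$. $L_N(x)=\sum_{k=0}^{N-1}1_{\{S_k=x\}}$ and $f_N(x)=\sqrt{L_N(x)}$. For $f:\mathbb{Z}^d\to\mathbb{R}$, $\|f\|_1=\sum_{x\in\mathbb{Z}^d}|f(x)|$ and $\mathcal{E}(f)=\frac1{2d}\sum_{y,z\in\mathbb{Z}^d,|y-z|=1}(f(y)-f(z))^2$ (ordered pairs). *)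

(* Defs.v *)
From HB Require Import structures.
From mathcomp Require Import all_boot all_order all_algebra.
From mathcomp Require Import all_classical all_reals all_analysis.
Set Implicit Arguments. Unset Strict Implicit. Unset Printing Implicit Defensive.
Import Order.TTheory GRing.Theory Num.Theory.
Local Open Scope classical_set_scope.
Local Open Scope ring_scope.

Definition Zd (d : nat) := 'rV[int]_d.

(* nearest neighbours: |y - z| = 1 (Euclidean = l1 on integer points) *)
Definition adj d (y z : Zd d) : bool := (\sum_(i < d) `|y ord0 i - z ord0 i|) == 1.

Definition step_vec d (k : 'I_(2 * d)) : Zd d :=
  \row_(j < d) (if val k == val j then 1 else if val k == (val j + d)%N then -1 else 0).

(* a walk of N steps is a sequence of step indices; all (2d)^N of them
   are equally likely under P for the simple random walk from 0 *)
Definition walk d N := {ffun 'I_N -> 'I_(2 * d)}.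

Definition pos d N (s : walk d N) (k : nat) : Zd d :=
  \sum_(j < N | (j < k)%N) step_vec (s j).

Definition loctime d N (s : walk d N) (x : Zd d) : nat :=
  #|[set k : 'I_N | pos s k == x]|.

Definition range_card d N (s : walk d N) : nat :=
  size (undup [seq pos s k | k <- iota 0 N.+1]).

Definition fN {R : realType} d N (s : walk d N) : Zd d -> R :=
  fun x => Num.sqrt (loctime s x)%:R.

Definition Eexp_range {R : realType} d N (F : set (Zd d -> R)) : R :=
  ((2 * d)%:R ^+ N)^-1 *
  \sum_(s : walk d N) (expR (- (range_card s)%:R) * (if `[< F (fN s) >] then 1 else 0)).

Definition l1norm {R : realType} d (h : Zd d -> R) : \bar R :=
  \esum_(x in [set: Zd d]) (`|h x|)%:E.

Definition dirichlet {R : realType} d (f : Zd d -> R) : \bar R :=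
  ((2 * d)%:R^-1)%:E *
  \esum_(p in [set p : Zd d * Zd d | adj p.1 p.2]) ((f p.1 - f p.2) ^+ 2)%:E.

Definition supp_card {R : realType} d (h : Zd d -> R) : \bar R :=
  \esum_(x in [set x : Zd d | 0 < h x]) 1%E.

Definition admissible {R : realType} d (n N : nat) (F : set (Zd d -> R)) :
  set (Zd d -> R) :=
  [set h : Zd d -> R | (forall x, 0 <= h x) /\ (l1norm h < +oo)%E /\
     exists2 f, F f &
       (l1norm (fun x : Zd d => (h x - f x ^+ 2 / N%:R)%R) <= (n%:R `^ (- (1 / 16)))%:E)%E].

(* the functional inside the infimum; for h in l^1, E(sqrt h) is finite,
   so taking [fine] of it loses nothing *)
Definition rate {R : realType} d (n N : nat) (h : Zd d -> R) : \bar R :=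
  (supp_card h +
   ((N%:R / 2) * (1 - n%:R `^ (- (1 / 4))) *
    (Num.max (Num.sqrt (fine (dirichlet (fun x => Num.sqrt (h x)))) - n%:R `^ (- (9 / 8))) 0) ^+ 2)%:E)%E.

(* Main.v *)
Require Import Defs.
From HB Require Import structures.
From mathcomp Require Import all_boot all_order all_algebra.
From mathcomp Require Import all_classical all_reals all_analysis.
From mathcomp Require Import ring lra zify.
Import Order.TTheory GRing.Theory Num.Theory.
Local Open Scope classical_set_scope.
Local Open Scope ring_scope.
Set Implicit Arguments.
Unset Strict Implicit.
Unset Printing Implicit Defensive.

(* Donsker-Varadhan upper bound.  For u > 0 the walk average of
   u(S_N)/u(0) prod_k (u/Pu)(S_k) is 1, so a finite class of test functions u
   controls the exponential moment of max_u sum_x L_N(x) (1 - Pu/u)(x).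
   With u = sqrt(max(L_N, 1)), a class of exp(O(n^d log n)) functions once
   |R_N| = O(n^d), this shows that, off an event of probability
   exp(-kappa n^d), L_N has small discrete gradient, hence is l^1-close to its
   average z over boxes of side M ~ n^(2/3).  Then
   h = (sqrt(max(z, t)) - sqrt t)^2 / N, with a small threshold t, is admissible
   and has at most |R_N| + o(n^(d - 1/8)) points in its support.
   By convexity (Jensen), the Dirichlet energy of sqrt h is dominated by the
   functional of u = exp(box average of log sqrt(max(z, t)/t)); this smooth u is
   replaced, by Maurey's sampling, by one of exp(o(n^(d - 1/8))) functions
   exp(c sum_{i <= Q} phi(y_i - x)) with Q ~ n^(d - 7/48) points y_i, and a
   second union bound concludes. *)

(** The obstacle is entropy. Write s = n^(1/96), D = n^d. The class recording sqrt(max(L_N, 1))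
    costs O(D s) in the exponent, more than the permitted error D s^(-12); it can only cap the
    energy at D s^2, an event whose failure is cheap. The main exponent needs a far smaller class.
    The logarithm of the smooth weight is a positive combination of box indicators, and a unit step
    changes such an indicator only on two faces of the box, so the sampling variance is negligible.
    Moreover one sample has to control only the sum, over times and steps, of the ratios u(x + e) /
    u(x): a first-moment choice is enough and u need not be approximated uniformly. The threshold
    lies in a window. Since the smoothing error is of order D s^162, the surplus support is below D
    s^(-12) only for t above s^174; and the l^1 error stays below n^(-1/16) = s^(-6) only for t
    below s^180 (up to constants). The choice t = s^176 is inside. *)

(** * Real sums of finitely supported functions *)

Definition finsupp {R : realType} {T : choiceType} (F : T -> R) : Prop :=
  finite_set [set x | F x != 0].

(** Keeps the computations in [R]; [esum_zsum] translates to extended sums. An infinite support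
    gives the default value 0, hence the [finsupp] hypotheses for additivity and monotonicity. *)
Definition zsum {R : realType} {T : choiceType} (F : T -> R) : R :=
  \sum_(x \in [set: T]) F x.

Section FiniteSupport.
Context {R : realType} {T : choiceType}.
Implicit Types F G : T -> R.

Lemma finsupp_sub F (A : set T) :
  finite_set A -> (forall x, ~ A x -> F x = 0) -> finsupp F.
Proof.
move=> fA h; apply: sub_finite_set fA => x /= /eqP Fx.
by have [//|/h] := pselect (A x).
Qed.

Lemma finsuppD F G : finsupp F -> finsupp G -> finsupp (fun x => F x + G x).
Proof.
move=> fF fG; apply: (@finsupp_sub _ ([set x | F x != 0] `|` [set x | G x != 0])).
  by rewrite finite_setU; split.
move=> x /= /not_orP [/negP /negPn /eqP -> /negP /negPn /eqP ->]; exact: addr0.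
Qed.

Lemma finsupp_dom F G : finsupp F -> (forall x, F x = 0 -> G x = 0) -> finsupp G.
Proof.
move=> fF h; apply: (finsupp_sub (A := [set x | F x != 0])) => // x /= /negP /negPn /eqP; exact: h.
Qed.

Lemma finsuppMl a F : finsupp F -> finsupp (fun x => a * F x).
Proof. by move=> fF; apply: (finsupp_dom fF) => x ->; rewrite mulr0. Qed.

Lemma eq_zsum F G : F =1 G -> zsum F = zsum G.
Proof. by move=> FG; apply: eq_fsbigr => x _. Qed.

Lemma zsum_seq F (r : seq T) : uniq r ->
  (forall x, x \notin r -> F x = 0) -> zsum F = \sum_(x <- r) F x.
Proof.
move=> ur h; rewrite (fsbig_seq _ _ ur) /zsum; apply/esym/fsbig_widen => //.
by move=> x [_ /= /negP]; exact: h.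
Qed.

Lemma zsumD F G : finsupp F -> finsupp G ->
  zsum (fun x => F x + G x) = zsum F + zsum G.
Proof.
move=> fF fG.
have /finite_seqP[A hA] : finite_set ([set x | F x != 0] `|` [set x | G x != 0]).
  by rewrite finite_setU; split.
have hF x : x \notin undup A -> F x = 0.
  rewrite mem_undup => /negP xA; apply: contrapT => /eqP Fx; apply: xA.
  have : [set` A] x by rewrite -hA; left.
  by [].
have hG x : x \notin undup A -> G x = 0.
  rewrite mem_undup => /negP xA; apply: contrapT => /eqP Gx; apply: xA.
  have : [set` A] x by rewrite -hA; right.
  by [].
rewrite (zsum_seq (undup_uniq A)); last by move=> x xA; rewrite hF // hG // addr0.
by rewrite (zsum_seq (undup_uniq A) hF) (zsum_seq (undup_uniq A) hG) big_split.
Qed.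

Lemma zsumMl a F : zsum (fun x => a * F x) = a * zsum F.
Proof. by rewrite /zsum -mulr_fsumr. Qed.

Lemma zsum_ge0 F : (forall x, 0 <= F x) -> 0 <= zsum F.
Proof. by move=> h; apply: fsumr_ge0. Qed.

Lemma zsumN F : zsum (fun x => - F x) = - zsum F.
Proof.
by rewrite -mulN1r -zsumMl; apply: eq_zsum => x; rewrite mulN1r.
Qed.

Lemma le_zsum F G : finsupp F -> finsupp G ->
  (forall x, F x <= G x) -> zsum F <= zsum G.
Proof.
move=> fF fG h; rewrite -subr_ge0 -zsumN -zsumD //; last first.
  by apply: (finsupp_dom fF) => x ->; rewrite oppr0.
by apply: zsum_ge0 => x; rewrite subr_ge0.
Qed.

Lemma zsum_sum (I : Type) (r : seq I) (F : I -> T -> R) :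
  (forall i, finsupp (F i)) ->
  finsupp (fun x => \sum_(i <- r) F i x) /\
  zsum (fun x => \sum_(i <- r) F i x) = \sum_(i <- r) zsum (F i).
Proof.
move=> fF; elim: r => [|i r [fr IH]].
  split; first by apply: (@finsupp_sub _ set0) => // x _; rewrite big_nil.
  by rewrite big_nil (zsum_seq (r := [::])) ?big_nil // => x _; rewrite big_nil.
have e : (fun x => \sum_(j <- i :: r) F j x) =
         (fun x => F i x + \sum_(j <- r) F j x).
  by apply/funext => x; rewrite big_cons.
by rewrite e; split; [exact: finsuppD | rewrite zsumD // big_cons IH].
Qed.

Lemma sum_inj_le_zsum (C : finType) (pt : C -> T) F : injective pt -> finsupp F ->
  (forall x, 0 <= F x) -> \sum_g F (pt g) <= zsum F.
Proof.
move=> ipt fF F0.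
have -> : \sum_g F (pt g) = zsum (fun x => if x \in codom pt then F x else 0).
  rewrite (zsum_seq (r := codom pt)).
  - rewrite big_map big_enum /=; apply: eq_bigr => g _; by rewrite codom_f.
  - by rewrite map_inj_uniq // enum_uniq.
  - by move=> x /negbTE ->.
apply: le_zsum => //; first by apply: (finsupp_dom fF) => x ->; case: ifP.
by move=> x; case: ifP.
Qed.

Lemma esum_zsum F : finsupp F -> (forall x, 0 <= F x) ->
  \esum_(x in [set: T]) (F x)%:E = (zsum F)%:E.
Proof.
move=> fF h.
have -> : \esum_(x in [set: T]) (F x)%:E = \esum_(x in [set x | F x != 0]) (F x)%:E.
  rewrite [RHS]esum_mkcond; apply: eq_esum => x _.
  by case: ifPn => //; rewrite notin_setE /= => /negP /negPn /eqP ->.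
rewrite esum_fset //; last by move=> x _; rewrite lee_fin.
rewrite /zsum (fsbig_finite _ _ fF) /= sumEFin; congr EFin.
apply/esym/zsum_seq => // x; rewrite in_fset_set // notin_setE /=.
by move=> /negP /negPn /eqP.
Qed.
End FiniteSupport.

(** * Occupation counts of a finite family of points *)

Section Occupation.
Context {R : realType} {T : choiceType} {I : finType} (p : I -> T).

Definition occ (x : T) : nat := #|[pred i | p i == x]|.

Lemma occE (x : T) : (occ x)%:R = \sum_i (p i == x)%:R :> R.
Proof.
rewrite /occ -sum1_card natr_sum big_mkcond /=.
by apply: eq_bigr => i _; rewrite unfold_in; case: eqP.
Qed.

Lemma occ0 x : x \notin codom p -> occ x = 0%N.
Proof.
move=> xp; apply: eq_card0 => i; rewrite inE; apply/negbTE/eqP => e.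
by rewrite -e codom_f in xp.
Qed.

Lemma occ_inj_le1 x : injective p -> (occ x <= 1)%N.
Proof.
move=> ip; rewrite leqNgt; apply/negP => /card_gt1P[i [j]]; rewrite !inE.
by case=> /eqP pi /eqP pj; apply/negP; rewrite negbK; apply/eqP/ip; rewrite pi.
Qed.

Lemma occ_dom (F : T -> R) : (forall x, occ x = 0%N -> F x = 0) -> finsupp F.
Proof.
move=> h; apply: (@finsupp_sub _ _ _ [set` codom p]); first exact: finite_seq.
by move=> x /= /negP xp; apply/h/occ0.
Qed.

(** The occupation time formula: it converts the sums along the path that the martingale produces
    into sums over sites. *)
Lemma zsum_occ (F : T -> R) : zsum (fun x => (occ x)%:R * F x) = \sum_i F (p i).
Proof.
rewrite (zsum_seq (r := undup (codom p))) ?undup_uniq //; last first.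
  by move=> x; rewrite mem_undup => /occ0 ->; rewrite mul0r.
under eq_bigr do rewrite occE mulr_suml.
rewrite exchange_big; apply: eq_bigr => i _ /=.
rewrite (bigD1_seq (p i)) ?undup_uniq ?mem_undup ?codom_f //= eqxx mul1r.
rewrite big1 ?addr0 // => x; rewrite eq_sym => /negbTE ->; exact: mul0r.
Qed.
End Occupation.

Section Translation.
Context {R : realType} {G : zmodType}.
Implicit Types (F : G -> R) (e : G).

Lemma zsum_shift e F : zsum (fun x => F (x + e)) = zsum F.
Proof.
rewrite /zsum; apply/esym.
rewrite (reindex_fsbigT (fun x => x + e)) //.
by exists (fun x => x - e) => x; rewrite ?addrK ?subrK.
Qed.

Lemma finsupp_shift e F : finsupp F -> finsupp (fun x => F (x + e)).
Proof.
move=> fF; apply: (@finsupp_sub _ _ _ ((fun x => x - e) @` [set x | F x != 0])).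
  exact: finite_image.
move=> x /= h; apply: contrapT => /eqP Fx; apply: h.
by exists (x + e); rewrite ?addrK.
Qed.
End Translation.

(** * Energy of the clamped square root of an occupation field *)

Section ClampedEnergy.
Context {R : realType} {G : zmodType} {I : finType} (p : I -> G).
Variables (a t : R) (t_gt0 : 0 < t).

(** Two uses: a = t = 1 for the local time itself, and a = 1/#|B| with [smeared] points for its box
    average. The floor [t] keeps the test function positive. *)
Definition clamp (x : G) : R := Num.sqrt (Num.max (a * (occ p x)%:R) t).

Lemma clamp_gt0 x : 0 < clamp x.
Proof. by rewrite sqrtr_gt0 lt_max t_gt0 orbT. Qed.

Lemma clamp_sqr x : clamp x ^+ 2 = Num.max (a * (occ p x)%:R) t.
Proof. by rewrite sqr_sqrtr // le_max (ltW t_gt0) orbT. Qed.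

Lemma sqrt_le_clamp x : Num.sqrt t <= clamp x.
Proof. by apply: ler_wsqrtr; rewrite le_max lexx orbT. Qed.

Lemma clamp_occ0 x : occ p x = 0%N -> clamp x = Num.sqrt t.
Proof. by rewrite /clamp => ->; rewrite mulr0 max_r // ltW. Qed.

Lemma finsupp_clamp (F : R -> R) :
  F (Num.sqrt t) = 0 -> finsupp (fun x => F (clamp x)).
Proof. by move=> F0; apply: (@occ_dom _ _ _ p) => x /clamp_occ0 ->. Qed.

Lemma finsupp_clamp_step e :
  finsupp (fun x => (clamp (x + e) - clamp x) ^+ 2).
Proof.
have f1 : finsupp (fun x => clamp x - Num.sqrt t).
  exact: (finsupp_clamp (F := fun y => y - Num.sqrt t) (subrr _)).
have f2 := finsupp_shift e f1.
have := finsuppD f2 (finsuppMl (-1) f1).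
move/finsupp_dom; apply => x h.
by apply/eqP; rewrite sqrf_eq0; apply/eqP; rewrite -[RHS]h; ring.
Qed.

(* Pointwise a^2 (1 - b/a) = ((b - a)^2 + a^2 - b^2) / 2, and the difference of squares telescopes. *)
Lemma clamp_energy_step e :
  2^-1 * zsum (fun x => (clamp (x + e) - clamp x) ^+ 2) <=
  a * \sum_i (1 - clamp (p i + e) / clamp (p i)).
Proof.
rewrite -(zsum_occ p (fun x => 1 - clamp (x + e) / clamp x)) -!zsumMl.
pose g x := clamp x ^+ 2 - t.
have fg : finsupp g.
  apply: (finsupp_clamp (F := fun y => y ^+ 2 - t)).
  by rewrite sqr_sqrtr ?subrr // ltW.
have fge := finsupp_shift e fg.
have fs := finsuppMl 2^-1 (finsupp_clamp_step e).
have fo : finsupp (fun x => a * ((occ p x)%:R * (1 - clamp (x + e) / clamp x))).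
  by apply: (@occ_dom _ _ _ p) => x ->; rewrite mul0r mulr0.
have fh : finsupp (fun x => 2^-1 * g x + - 2^-1 * g (x + e)).
  by apply: finsuppD; apply: finsuppMl.
have h0 : zsum (fun x => 2^-1 * g x + - 2^-1 * g (x + e)) = 0.
  rewrite zsumD ?zsumMl ?zsum_shift; [by ring | exact: finsuppMl..].
rewrite -[leLHS]addr0 -{}h0 -zsumD //; apply: le_zsum => //; first exact: finsuppD.
move=> x; rewrite /g /=.
set A := clamp x; set B := clamp (x + e).
have A0 : 0 < A := clamp_gt0 x.
rewrite [leLHS](_ : _ = A ^+ 2 * (1 - B / A)); last by field; rewrite gt_eqF.
rewrite mulrA /A clamp_sqr -/A; case: (leP t (a * (occ p x)%:R)) => // lt_t.
have e1 : A = Num.sqrt t by rewrite /A /clamp max_r // ltW.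
(* Below the threshold [A] is the minimum of the clamp, so 1 - B/A is nonpositive and replacing t by
   the smaller a * occ only increases the term. *)
have B1 : 1 <= B / A by rewrite ler_pdivlMr // mul1r e1 sqrt_le_clamp.
by rewrite ler_wnM2r ?subr_le0 // ltW.
Qed.
End ClampedEnergy.

(** * Exponential martingales of a walk on an abelian group *)

Section Walk.
Context {R : realType} {G : zmodType} {K : finType} (st : K -> G).

(** [pos] is the instance [st := step_vec] by conversion; the martingale part needs no lattice
    structure. *)
Definition wpos N (s : {ffun 'I_N -> K}) (k : nat) : G :=
  \sum_(j < N | (j < k)%N) st (s j).

Definition wext N (s : {ffun 'I_N -> K}) (c : K) : {ffun 'I_N.+1 -> K} :=
  [ffun i => if unlift ord_max i is Some j then s j else c].

Lemma wext_bij N :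
  bijective (fun q : {ffun 'I_N -> K} * K => wext q.1 q.2).
Proof.
exists (fun s : {ffun 'I_N.+1 -> K} => ([ffun j => s (lift ord_max j)], s ord_max)).
  case=> s c /=; congr pair; last by rewrite ffunE unlift_none.
  by apply/ffunP => j; rewrite !ffunE liftK.
move=> s; apply/ffunP => i; rewrite ffunE /=.
by case: unliftP => [j ->|->] //=; rewrite ffunE.
Qed.

Lemma wpos_ext N (s : {ffun 'I_N -> K}) c k : (k <= N)%N ->
  wpos (wext s c) k = wpos s k.
Proof.
move=> kN; rewrite /wpos big_mkcond big_ord_recr /= [RHS]big_mkcond /=.
rewrite ltnNge kN /= addr0; apply: eq_bigr => j _; case: ifP => // _.
rewrite ffunE; have -> : widen_ord (leqnSn N) j = lift ord_max j.
  by apply/val_inj; rewrite /= /bump leqNgt ltn_ord.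
by rewrite liftK.
Qed.

Lemma wpos_ext_last N (s : {ffun 'I_N -> K}) c :
  wpos (wext s c) N.+1 = wpos s N + st c.
Proof.
rewrite /wpos big_mkcond big_ord_recr /= [in RHS]big_mkcond /=.
rewrite ltnSn ffunE unlift_none; congr (_ + _); apply: eq_bigr => j _.
rewrite ltn_ord leqW ?ltn_ord //.
rewrite ffunE; have -> : widen_ord (leqnSn N) j = lift ord_max j.
  by apply/val_inj; rewrite /= /bump leqNgt ltn_ord.
by rewrite liftK.
Qed.

Definition wmean (u : G -> R) (x : G) : R := (#|K|%:R)^-1 * \sum_c u (x + st c).

Lemma wmean_gt0 (u : G -> R) x : (0 < #|K|)%N -> (forall y, 0 < u y) -> 0 < wmean u x.
Proof.
move=> K0 u0; rewrite mulr_gt0 ?invr_gt0 ?ltr0n //.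
case/card_gt0P: K0 => c _; rewrite (bigD1 c) //= ltr_pwDl // sumr_ge0 // => c' _.
exact: ltW.
Qed.

(** Averaging over the last step replaces u at the endpoint by [wmean] at the previous position,
    which cancels the last denominator. *)
Lemma walk_martingale (u : G -> R) N : (0 < #|K|)%N -> (forall y, 0 < u y) ->
  \sum_(s : {ffun 'I_N -> K})
     (\prod_(k < N) (u (wpos s k) / wmean u (wpos s k)) * u (wpos s N)) =
  #|K|%:R ^+ N * u 0.
Proof.
move=> K0 u0; elim: N => [|N IH].
  rewrite (eq_bigr (fun=> u 0)); last first.
    by move=> s _; rewrite big_ord0 mul1r /wpos big_ord0.
  by rewrite sumr_const card_ffun card_ord expn0 expr0 mul1r.
rewrite (reindex _ (onW_bij _ (wext_bij N))) /=.
rewrite -(pair_bigA _ (fun s c => \prod_(k < N.+1)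
  (u (wpos (wext s c) k) / wmean u (wpos (wext s c) k)) *
  u (wpos (wext s c) N.+1))) /=.
rewrite exprS -mulrA -IH mulr_sumr; apply: eq_bigr => s _.
rewrite (eq_bigr (fun c => (\prod_(k < N) (u (wpos s k) / wmean u (wpos s k)) *
   (u (wpos s N) / wmean u (wpos s N))) * u (wpos s N + st c))); last first.
  move=> c _; rewrite big_ord_recr /= wpos_ext // wpos_ext_last; congr (_ * _ * _).
  by apply: eq_bigr => k _; rewrite wpos_ext // ltnW.
rewrite -mulr_sumr.
have -> : \sum_c u (wpos s N + st c) = #|K|%:R * wmean u (wpos s N).
  by rewrite /wmean mulrA divff ?mul1r // pnatr_eq0 -lt0n.
have := wmean_gt0 (wpos s N) K0 u0.
set m := wmean u _ => m0; field; rewrite gt_eqF //.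
Qed.

(** Factor by factor, this is 1 + y <= e^y at y = m/v - 1, inverted. *)
Lemma prod_ge_expR (u : G -> R) N (s : {ffun 'I_N -> K}) :
  (0 < #|K|)%N -> (forall y, 0 < u y) ->
  expR (\sum_(k < N) (1 - wmean u (wpos s k) / u (wpos s k))) <=
  \prod_(k < N) (u (wpos s k) / wmean u (wpos s k)).
Proof.
move=> K0 u0; rewrite expR_sum; apply: ler_prod => k _.
rewrite expR_ge0 /=; have := wmean_gt0 (wpos s k) K0 u0.
set m := wmean u _; set v := u _ => m0; have v0 : 0 < v := u0 _.
rewrite -[leRHS]invrK invf_div -ler_pV2 ?inE ?unitfE; last first.
- by rewrite gt_eqF ?expR_gt0 // expR_gt0.
- by rewrite invr_gt0 divr_gt0 // gt_eqF // invr_gt0 divr_gt0.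
rewrite invrK -expRN; apply: le_trans (expR_ge1Dx _); lra.
Qed.
End Walk.

(** * Elementary inequalities for the exponential *)

Section Exponential.
Context {R : realType}.

Lemma expR_le_inv (x : R) : x < 1 -> expR x <= (1 - x)^-1.
Proof.
move=> x1; rewrite -[leLHS]invrK -expRN lef_pV2 ?posrE ?subr_gt0 ?expR_gt0 //.
exact: expR_ge1Dx.
Qed.

(** There is no lower bound on x, so the sampling argument needs only upper bounds on the
    increments. *)
Lemma expR_le_quadratic (x : R) : x <= 2^-1 -> expR x <= 1 + x + 2 * x ^+ 2.
Proof.
move=> x2; apply: le_trans (expR_le_inv _) _; first lra.
rewrite -[leRHS]divr1 -div1r ler_pdivrMr ?subr_gt0; last lra.
rewrite divr1 -subr_ge0.
rewrite (_ : _ - _ = x ^+ 2 * (1 - 2 * x)); last by ring.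
by rewrite mulr_ge0 ?sqr_ge0 //; lra.
Qed.

Lemma expR_le1D2 (x : R) : 0 <= x <= 2^-1 -> expR x <= 1 + 2 * x.
Proof.
case/andP=> x0 x2; apply: le_trans (expR_le_quadratic x2) _.
have : 0 <= x * (1 - 2 * x) by rewrite mulr_ge0 //; lra.
rewrite expr2; lra.
Qed.

(** Sum over y of the tangent line inequality at the mean [A], whose linear terms cancel. *)
Lemma expR_mean_le (Y : finType) (f : Y -> R) : (0 < #|Y|)%N ->
  expR ((#|Y|%:R)^-1 * \sum_y f y) <= (#|Y|%:R)^-1 * \sum_y expR (f y).
Proof.
move=> Y0; set A := _ * \sum_y f y.
have nz : #|Y|%:R != 0 :> R by rewrite pnatr_eq0 -lt0n.
rewrite -[leLHS](mulKf nz) ler_pM2l ?invr_gt0 ?ltr0n //.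
have -> : #|Y|%:R * expR A = \sum_y (expR A * (1 + (f y - A))).
  rewrite -mulr_sumr big_split sumrB /= !sumr_const.
  rewrite -[A *+ _]mulr_natl {3}/A mulVKf // subrr addr0; exact: mulrC.
apply: ler_sum => y _; rewrite -[in leRHS](subrK A (f y)) expRD mulrC.
by rewrite ler_pM2r ?expR_gt0 // expR_ge1Dx.
Qed.
End Exponential.

(** * Random sampling of a linear exponent *)

Section Maurey.
Context {R : realType} {C J : finType}.

(* Maurey's empirical method: a sum with weights w is replaced by Q independent
   draws from w / (c Q), with None carrying the missing mass. *)
Lemma maurey (w : C -> R) (D : J -> C -> R) (c eta : R) (Q : nat) :
  (forall g, 0 <= w g) -> 0 < c -> (0 < Q)%N -> \sum_g w g <= c * Q%:R ->
  (forall j g, c * D j g <= 2^-1) ->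
  (forall j, 2 * c * \sum_g w g * D j g ^+ 2 <= eta) ->
  exists tau : {ffun 'I_Q -> option C},
    \sum_j expR (\sum_(i < Q) oapp (fun g => c * D j g) 0 (tau i)) <=
    expR eta * \sum_j expR (\sum_g w g * D j g).
Proof.
move=> w0 c0 Q0 wQ hD heta.
have Q0' : 0 < Q%:R :> R by rewrite ltr0n.
have cQ : 0 < c * Q%:R by exact: mulr_gt0.
pose al j o : R := oapp (fun g => c * D j g) 0 o.
pose pr o : R := oapp (fun g => w g / (c * Q%:R)) (1 - (\sum_g w g) / (c * Q%:R)) o.
have bo (F : option C -> R) : \sum_o F o = F None + \sum_g F (Some g).
  by rewrite (bigD1 None) //= (reindex_omap Some id) //=; [congr (_ + _); apply: eq_bigl => g; rewrite eqxx | case].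
have pr0 o : 0 <= pr o.
  case: o => [g|] /=; first by rewrite divr_ge0 // ltW.
  by rewrite subr_ge0 ler_pdivrMr // mul1r.
have pr1 : \sum_o pr o = 1 by rewrite bo /= -mulr_suml subrK.
pose Pr (tau : {ffun 'I_Q -> option C}) := \prod_i pr (tau i).
have Pr0 tau : 0 <= Pr tau by apply: prodr_ge0.
have Pr1 : \sum_tau Pr tau = 1.
  rewrite -(bigA_distr_bigA (fun (_ : 'I_Q) o => pr o)) /= big1 // => i _.
(* Independence turns the expectation into a Q-th power. A single factor is at most 1 + mean + 2
   (second moment); the mean is the Q-th part of the target exponent and the second-moment term at
   most eta / Q. *)
have ineq j : \sum_tau Pr tau * expR (\sum_(i < Q) al j (tau i)) <=
    expR eta * expR (\sum_g w g * D j g).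
  rewrite (eq_bigr (fun tau : {ffun 'I_Q -> option C} =>
     \prod_i (pr (tau i) * expR (al j (tau i))))); last first.
    by move=> tau _; rewrite expR_sum -big_split.
  rewrite -(bigA_distr_bigA (fun (_ : 'I_Q) o => pr o * expR (al j o))) /=.
  rewrite prodr_const card_ord -expRD.
  have -> : eta + \sum_g w g * D j g =
      ((eta + \sum_g w g * D j g) / Q%:R) * Q%:R by rewrite divfK // gt_eqF.
  rewrite expRM_natr; apply: lerXn2r.
  - by rewrite nnegrE sumr_ge0 // => o _; rewrite mulr_ge0 ?expR_ge0.
  - by rewrite nnegrE expR_ge0.
  apply: le_trans (expR_ge1Dx _).
  have le1 o : pr o * expR (al j o) <= pr o * (1 + al j o + 2 * al j o ^+ 2).
    rewrite ler_wpM2l // expR_le_quadratic //.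
    by case: o => [g|] //=; rewrite invr_ge0.
  apply: le_trans (ler_sum _ (fun o _ => le1 o)) _.
  under eq_bigr do rewrite mulrDr mulrDr mulr1.
  rewrite !big_split /= pr1 -addrA lerD2l !bo /= mulr0 expr0n /= !mulr0 !add0r.
  rewrite [leRHS]mulrDl addrC lerD //.
    rewrite ler_pdivlMr //; apply: le_trans (heta j).
    rewrite mulr_sumr mulr_suml le_eqVlt; apply/orP; left; apply/eqP.
    by apply: eq_bigr => g _; field; rewrite !gt_eqF.
  rewrite mulr_suml le_eqVlt; apply/orP; left; apply/eqP.
  by apply: eq_bigr => g _; field; rewrite !gt_eqF.
set Y := expR eta * _; pose X (tau : {ffun 'I_Q -> option C}) := \sum_j expR (\sum_(i < Q) al j (tau i)).
(* First-moment argument: if every [X tau] exceeded [Y], the bound on the mean would force all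
   probabilities [Pr tau] to vanish. *)
apply: contrapT => /forallNP noX.
have XY tau : Y < X tau by rewrite ltNge; apply/negP => h; exact: (noX tau h).
have sumX : \sum_tau Pr tau * X tau <= Y.
  under eq_bigr do rewrite mulr_sumr.
  rewrite exchange_big /Y mulr_sumr; apply: ler_sum => j _; exact: ineq.
have : \sum_tau Pr tau * (X tau - Y) <= 0.
  under eq_bigr do rewrite mulrBr.
  by rewrite sumrB -mulr_suml Pr1 mul1r subr_le0.
have ge tau : 0 <= Pr tau * (X tau - Y) by rewrite mulr_ge0 // subr_ge0 ltW.
move=> le0; have /eqP : \sum_tau Pr tau * (X tau - Y) = 0.
  by apply/eqP; rewrite eq_le le0 sumr_ge0.
rewrite psumr_eq0 // => /allP all0.
have : (1 : R) = 0.
  rewrite -Pr1; apply: big1 => tau _.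
  have := all0 tau (mem_index_enum _); rewrite mulf_eq0 subr_eq0 => /orP[/eqP //|].
  by rewrite gt_eqF.
by move/eqP; rewrite oner_eq0.
Qed.
End Maurey.

(** * Smoothing a test function by box averages and sampling it *)

Section Smoothing.
Context {R : realType} {G : zmodType} {K B C I : finType}.
Context (st : K -> G) (b : B -> G) (pt : C -> G) (q : I -> G).

(* The logarithm is the B-average of Q point masses of height c placed at the points of tau. *)
Definition sample_weight (c : R) (Q : nat) (tau : {ffun 'I_Q -> option C}) (x : G) : R :=
  expR (\sum_(i < Q) oapp (fun g => c * ((#|B|%:R)^-1 * (occ b (pt g - x))%:R)) 0 (tau i)).

(** Encodes a box average as an occupation count: [occ smeared] divided by #|B| is the average of
    [occ q] over translates by the points of [b], so the results on [clamp] apply to it. *)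
Definition smeared (z : I * B) : G := q z.1 + b z.2.

(** Exhibits the averaged function as a combination of translated box indicators with weights
    [v (pt g)], the linear form that [maurey] can sample. *)
Lemma average_candidates (v : G -> R) x : injective pt ->
  (forall y, y \notin codom pt -> v y = 0) ->
  (#|B|%:R)^-1 * \sum_y v (x + b y) =
  \sum_g v (pt g) * ((#|B|%:R)^-1 * (occ b (pt g - x))%:R).
Proof.
move=> ipt v0.
rewrite -(zsum_occ b (fun z => v (x + z))) -(zsum_shift (- x)) -zsumMl.
rewrite (zsum_seq (r := codom pt)).
- rewrite big_map big_enum /=; apply: eq_bigr => g _.
  by rewrite [x + _]addrC subrK; ring.
- by rewrite map_inj_uniq // enum_uniq.
- by move=> y yp; rewrite [x + _]addrC subrK v0 // !mulr0.
Qed.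

(** With V the box average of v, Jensen bounds exp(V(q i + e) - V(q i)) by the box average of the
    ratios of w, and [clamp_energy_step] bounds their sum by #|I| minus the energy. Sampling
    multiplies this sum by at most e^eta <= 1 + 2 eta, whence the loss 2 eta #|I|. *)
Lemma smoothing_energy (t c delta vmax eta : R) (Q : nat) :
  (0 < #|K|)%N -> (0 < #|B|)%N -> 0 < t -> injective pt -> injective b ->
  (forall z, smeared z \in codom pt) ->
  let w := clamp smeared (#|B|%:R)^-1 t in
  let v x := ln (w x / Num.sqrt t) in
  0 < c -> (0 < Q)%N -> c / #|B|%:R <= 2^-1 ->
  (forall x, v x <= vmax) -> \sum_g v (pt g) <= c * Q%:R ->
  (forall e, (#|B|%:R)^-1 * zsum (fun z => `|(occ b (z - st e))%:R - (occ b z)%:R| : R) <= delta) ->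
  2 * c * vmax * delta / #|B|%:R <= eta -> 0 <= eta <= 2^-1 ->
  exists tau : {ffun 'I_Q -> option C},
    (2 * #|K|%:R)^-1 * \sum_e zsum (fun x => (w (x + st e) - w x) ^+ 2)
      - 2 * eta * #|I|%:R <=
    \sum_i (1 - wmean st (sample_weight c tau) (q i) / sample_weight c tau (q i)).
Proof.
move=> K0 B0 t0 ipt ib cov w v c0 Q0 cB hv hQ hd heta eta2.
have nB : 0 < #|B|%:R :> R by rewrite ltr0n.
have nK : 0 < #|K|%:R :> R by rewrite ltr0n.
have st0 : 0 < Num.sqrt t by rewrite sqrtr_gt0.
have w0 x : 0 < w x by apply: clamp_gt0.
have v_ge0 x : 0 <= v x.
  by rewrite ln_ge0 // ler_pdivlMr // mul1r sqrt_le_clamp.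
have vpt y : y \notin codom pt -> v y = 0.
  move=> yp; rewrite /v /w clamp_occ0 ?divff ?ln1 // ?gt_eqF //.
  by apply: occ0; apply: contra yp => /codomP[z ->].
pose m : R := (#|B|%:R)^-1; have m0 : 0 < m by rewrite invr_gt0.
pose phi z : R := m * (occ b z)%:R.
pose D (j : I * K) g : R := phi (pt g - (q j.1 + st j.2)) - phi (pt g - q j.1).
have occ1 z : (occ b z <= 1)%N by exact: occ_inj_le1.
have phi_bd z : 0 <= phi z <= m.
  rewrite /phi mulr_ge0 ?ler0n ?(ltW m0) //=.
  by rewrite -[leRHS]mulr1 ler_pM2l // lern1 occ1.
have Dm j g : `|D j g| <= m.
  rewrite /D ler_norml; have := phi_bd (pt g - (q j.1 + st j.2)).
  have := phi_bd (pt g - q j.1); lra.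
have fphi : finsupp (fun z => (occ b z)%:R : R) by apply: (@occ_dom _ _ _ b) => x ->.
have sumD j : \sum_g `|D j g| <= delta.
  apply: le_trans (hd j.2).
  rewrite -(zsum_shift (- q j.1)) -zsumMl.
  rewrite (eq_bigr (fun g => m * `|(occ b (pt g - q j.1 - st j.2))%:R -
      (occ b (pt g - q j.1))%:R|)); last first.
    move=> g _; rewrite /D /phi -mulrBr normrM (gtr0_norm m0).
    by rewrite opprD addrA.
  pose F (z : G) : R := m * `|(occ b (z - q j.1 - st j.2))%:R - (occ b (z - q j.1))%:R|.
  rewrite -[leRHS]/(zsum F).
  have fF : finsupp F.
    apply: finsuppMl; have f1 := finsupp_shift (- q j.1) fphi.
    apply: (finsupp_dom (finsuppD (finsupp_shift (- st j.2) f1) f1)) => x /eqP.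
    rewrite addrAC paddr_eq0 ?ler0n // => /andP[/eqP -> /eqP ->].
    by rewrite subrr normr0.
  by apply: (sum_inj_le_zsum ipt fF) => x; rewrite mulr_ge0 // ltW.
(* One factor |D| is bounded by the height 1/#|B| of the indicator, the other is summed with [sumD],
   where the small boundary of the box enters. *)
have hvar j : 2 * c * \sum_g v (pt g) * D j g ^+ 2 <= eta.
  apply: le_trans heta.
  rewrite (_ : _ / _ = 2 * c * (vmax * m * delta)); last by rewrite /m; ring.
  rewrite ler_pM2l ?mulr_gt0 //.
  apply: (@le_trans _ _ (\sum_g vmax * m * `|D j g|)).
    apply: ler_sum => g _; rewrite -real_normK ?num_real // expr2 mulrA.
    by rewrite ler_wpM2r // ler_pM.
  have vm0 : 0 <= vmax by apply: le_trans (v_ge0 0) (hv 0).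
  by rewrite -mulr_sumr ler_wpM2l // mulr_ge0 // ltW.
have [tau Htau] := @maurey R C (I * K)%type (fun g => v (pt g)) D c eta Q
  (fun g => v_ge0 _) c0 Q0 hQ
  (fun j g => le_trans (ler_wpM2l (ltW c0) (le_trans (ler_norm _) (Dm j g))) cB)
  hvar.
exists tau.
set W := sample_weight c tau.
pose V x := m * \sum_y v (x + b y).
have VE x : V x = \sum_g v (pt g) * phi (pt g - x) by apply: average_candidates.
pose rat (z : I * B) (e : K) := w (smeared z + st e) / w (smeared z).
pose X e := m * \sum_z rat z e.
have jensen (j : I * K) : expR (\sum_g v (pt g) * D j g) <=
    m * \sum_y rat (j.1, y) j.2.
  have -> : \sum_g v (pt g) * D j g =
      m * \sum_y (v (q j.1 + st j.2 + b y) - v (q j.1 + b y)).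
    rewrite sumrB mulrBr -/(V (q j.1 + st j.2)) -/(V (q j.1)) !VE -sumrB.
    by apply: eq_bigr => g _; rewrite mulrBr.
  apply: le_trans (expR_mean_le _ B0) _; rewrite ler_pM2l // le_eqVlt.
  apply/orP; left; apply/eqP/eq_bigr => y _.
  rewrite /v -ln_div ?posrE ?divr_gt0 // lnK ?posrE ?divr_gt0 //.
  rewrite /rat /smeared /= [_ + st _ + b _]addrAC.
  have := w0 (q j.1 + b y); set A := w (q _ + b _) => A0.
  by field; rewrite !gt_eqF.
have sumj : \sum_(j : I * K) expR (\sum_g v (pt g) * D j g) <= \sum_e X e.
  apply: le_trans (ler_sum _ (fun j _ => jensen j)) _.
  rewrite -(pair_bigA _ (fun i e => m * \sum_y rat (i, y) e)) /= exchange_big /=.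
  apply: ler_sum => e _; rewrite /X -(pair_bigA _ (fun i y => rat (i, y) e)) /=.
  by rewrite mulr_sumr.
have Xe e : X e <= #|I|%:R - 2^-1 * zsum (fun x => (w (x + st e) - w x) ^+ 2).
  have := @clamp_energy_step R G _ smeared m t t0 (st e).
  rewrite sumrB sumr_const card_prod mulrBr -/(X e) -mulr_natl mulr1 natrM.
  rewrite -/w mulrCA mulVf ?gt_eqF // mulr1; lra.
have ratE i e : W (q i + st e) / W (q i) =
   expR (\sum_(k < Q) oapp (fun g => c * D (i, e) g) 0 (tau k)).
  rewrite /W /sample_weight -expRN -expRD -sumrB; congr expR.
  apply: eq_bigr => k _; case: (tau k) => [g|] /=; last by rewrite subrr.
  by rewrite -mulrBr.
have -> : \sum_i (1 - wmean st W (q i) / W (q i)) =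
   #|I|%:R - #|K|%:R^-1 * \sum_j expR (\sum_(k < Q) oapp (fun g => c * D j g) 0 (tau k)).
  rewrite sumrB sumr_const; congr (_ - _).
  rewrite -(pair_bigA _ (fun i e => expR (\sum_(k < Q) oapp (fun g => c * D (i, e) g) 0 (tau k)))) /=.
  rewrite mulr_sumr; apply: eq_bigr => i _; rewrite /wmean -mulrA mulr_suml.
  by congr (_ * _); apply: eq_bigr => e _; rewrite ratE.
have SX : #|K|%:R^-1 * \sum_e X e <= #|I|%:R -
   (2 * #|K|%:R)^-1 * \sum_e zsum (fun x => (w (x + st e) - w x) ^+ 2).
  rewrite mulrC ler_pdivrMr //; apply: le_trans (ler_sum _ (fun e _ => Xe e)) _.
  rewrite sumrB sumr_const -mulr_sumr -mulr_natl le_eqVlt; apply/orP; left.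
  by apply/eqP; field; rewrite gt_eqF.
have E0 : 0 <= (2 * #|K|%:R)^-1 * \sum_e zsum (fun x => (w (x + st e) - w x) ^+ 2).
  apply: mulr_ge0; rewrite ?invr_ge0 ?mulr_ge0 ?ler0n //; apply: sumr_ge0 => e _.
  by apply: zsum_ge0 => x; exact: sqr_ge0.
have main : #|K|%:R^-1 * \sum_j expR (\sum_(k < Q) oapp (fun g => c * D j g) 0 (tau k))
    <= (1 + 2 * eta) * (#|K|%:R^-1 * \sum_e X e).
  rewrite mulrCA ler_pM2l ?invr_gt0 //; apply: le_trans Htau _.
  apply: le_trans (ler_wpM2l (expR_ge0 _) sumj) _.
  apply: ler_wpM2r; last exact: expR_le1D2.
  apply: sumr_ge0 => e _.
  by rewrite mulr_ge0 ?(ltW m0) // sumr_ge0 // => z _; rewrite divr_ge0 // ltW.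
have := ler_wpM2l (_ : 0 <= 1 + 2 * eta) SX.
move: main E0 SX; set A := #|K|%:R^-1 * _; set S := _^-1 * \sum_e X e; set E := _^-1 * \sum_e _.
move=> main E0 SX /(_ ltac:(case/andP: eta2 => *; lra)) main2.
have : 0 <= eta * E by rewrite mulr_ge0 //; case/andP: eta2.
lra.
Qed.
End Smoothing.

(** * Total variation under translations *)

Section TotalVariation.
Context {R : realType} {G : zmodType}.
Implicit Types F : G -> R.

Definition tv (F : G -> R) (y : G) : R := zsum (fun x => `|F (x + y) - F x|).

Lemma finsuppB_norm (T : choiceType) (F F' : T -> R) :
  finsupp F -> finsupp F' -> finsupp (fun x => `|F x - F' x|).
Proof.
move=> f f'.
apply: (finsupp_dom (finsuppD (finsupp_dom f (G := fun x => `|F x|) _)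
  (finsupp_dom f' (G := fun x => `|F' x|) _))) => x; try by move=> ->; rewrite normr0.
by move/eqP; rewrite paddr_eq0 // !normr_eq0 => /andP[/eqP -> /eqP ->]; rewrite subrr normr0.
Qed.

Lemma finsupp_tv F y : finsupp F -> finsupp (fun x => `|F (x + y) - F x|).
Proof. by move=> f; apply: finsuppB_norm => //; exact: finsupp_shift. Qed.

Lemma tv0 F : tv F 0 = 0.
Proof.
rewrite /tv (zsum_seq (r := [::])) ?big_nil // => x _.
by rewrite addr0 subrr normr0.
Qed.

Lemma tvN F y : tv F (- y) = tv F y.
Proof.
rewrite /tv -(zsum_shift y); apply: eq_zsum => x; rewrite addrK distrC //.
Qed.

(** Subadditivity in the shift reduces the translations inside a box to unit steps. *)
Lemma tvD F y z : finsupp F -> tv F (y + z) <= tv F y + tv F z.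
Proof.
move=> f; rewrite /tv -[X in _ <= X + _](zsum_shift z) -zsumD.
- apply: le_zsum; first exact: finsupp_tv.
    apply: finsuppD; last exact: finsupp_tv.
    exact: (finsupp_shift z (finsupp_tv y f)).
  by move=> x; rewrite [y + z]addrC addrA; apply: ler_distD.
- exact: (finsupp_shift z (finsupp_tv y f)).
- exact: finsupp_tv.
Qed.

Lemma tv_sum F (I : Type) (r : seq I) (y : I -> G) : finsupp F ->
  tv F (\sum_(i <- r) y i) <= \sum_(i <- r) tv F (y i).
Proof.
move=> f; elim: r => [|i r IH]; first by rewrite !big_nil tv0.
rewrite !big_cons; apply: le_trans (tvD _ _ f) _; exact: lerD.
Qed.

Lemma tvMn F y n : finsupp F -> tv F (y *+ n) <= tv F y *+ n.
Proof.
move=> f; elim: n => [|n IH]; first by rewrite mulr0n tv0.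
rewrite !mulrS; apply: le_trans (tvD _ _ f) _; exact: lerD.
Qed.
End TotalVariation.

(** * The averaged and thresholded local time *)

Section Profile.
Context {R : realType} {G : zmodType} {I B : finType}.
Context (q : I -> G) (b : B -> G).

Definition nsites : nat := size (undup (codom q)).

Lemma finsupp_occ (T : choiceType) (J : finType) (p : J -> T) :
  finsupp (fun x => (occ p x)%:R : R).
Proof. by apply: (@occ_dom _ _ _ p) => x ->. Qed.

Lemma zsum_occ1 (J : finType) (p : J -> G) :
  zsum (fun x => (occ p x)%:R : R) = #|J|%:R.
Proof.
rewrite -sumr_const -(zsum_occ p (fun=> 1)).
by apply: eq_zsum => x; rewrite mulr1.
Qed.

Lemma occ_gt0 (J : finType) (p : J -> G) x : (0 < occ p x)%N = (x \in codom p).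
Proof.
apply/idP/idP => [|/codomP[i ->]].
  by case/card_gt0P => i; rewrite inE => /eqP <-; exact: codom_f.
by apply/card_gt0P; exists i; rewrite inE.
Qed.

Lemma finsupp_visited : finsupp (fun x => (0 < occ q x)%N%:R : R).
Proof. by apply: (@occ_dom _ _ _ q) => x ->. Qed.

Lemma zsum_visited : zsum (fun x => (0 < occ q x)%N%:R : R) = nsites%:R.
Proof.
rewrite (zsum_seq (r := undup (codom q))) ?undup_uniq //; last first.
  by move=> x; rewrite mem_undup occ_gt0 => /negbTE ->.
rewrite big_seq (eq_bigr (fun=> 1)).
  by rewrite -big_seq big_const_seq count_predT iter_addr addr0.
by move=> x; rewrite mem_undup occ_gt0 => ->.
Qed.

(* The cross term |W' - W| (W' + W) is split by AM-GM with weight l, and vanishes unless one of the two sites is visited. *)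
Lemma tv_occ_le (l : R) e : 0 < l ->
  tv (fun x => (occ q x)%:R) e <=
  l / 2 * zsum (fun x => (clamp q 1 1 (x + e) - clamp q 1 1 x) ^+ 2 : R) +
  4 / l * #|I|%:R + 2 * nsites%:R.
Proof.
move=> l0.
set L : G -> R := fun x => (occ q x)%:R.
set W := clamp q 1 1; set V : G -> R := fun x => (0 < occ q x)%N%:R.
have fL : finsupp L := finsupp_occ q.
have fV : finsupp V := finsupp_visited.
have fE : finsupp (fun x => (W (x + e) - W x) ^+ 2) by exact: finsupp_clamp_step.
have -> : l / 2 * zsum (fun x => (W (x + e) - W x) ^+ 2) + 4 / l * #|I|%:R + 2 * nsites%:R =
    zsum (fun x => (l / 2 * (W (x + e) - W x) ^+ 2 + 2 / l * (L (x + e) + L x)) + (V (x + e) + V x)).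
  have f1 := finsuppD (finsupp_shift e fL) fL.
  have f2 := finsuppD (finsupp_shift e fV) fV.
  have f3 := finsuppMl (l / 2) fE.
  have f4 := finsuppMl (2 / l) f1.
  rewrite (zsumD (finsuppD f3 f4) f2) (zsumD f3 f4) !zsumMl.
  rewrite (zsumD (finsupp_shift e fL) fL) (zsumD (finsupp_shift e fV) fV).
  by rewrite !zsum_shift zsum_occ1 zsum_visited; ring.
apply: le_zsum; first exact: finsupp_tv.
  apply: finsuppD; last by apply: finsuppD => //; exact: finsupp_shift.
  apply: finsuppD; apply: finsuppMl => //.
  by apply: finsuppD => //; exact: finsupp_shift.
move=> x.
have WE y : W y ^+ 2 = L y + 1 - V y.
  rewrite /W clamp_sqr // mul1r /L /V; case: (occ q y) => [|n] /=.
    by rewrite max_r // add0r subr0.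
  by rewrite max_l ?ler1n // addrK.
have W0 y : 0 < W y by exact: clamp_gt0.
have VL y : 0 <= V y <= 1 /\ V y <= L y.
  by rewrite /V /L; case: (occ q y) => [|n]; rewrite /= ?lexx ?ler01 ?ler1n.
have key : `|W (x + e) ^+ 2 - W x ^+ 2| <=
    l / 2 * (W (x + e) - W x) ^+ 2 + 2 / l * (L (x + e) + L x).
  have [n0|n0] := leqP (occ q (x + e) + occ q x) 0.
    have /andP[/eqP o1 /eqP o2] : (occ q (x + e) == 0%N) && (occ q x == 0%N).
      by rewrite -addn_eq0 -leqn0.
    rewrite !WE /V /L o1 o2 subrr normr0 addr0 mulr0 addr0.
    by rewrite mulr_ge0 ?sqr_ge0 // divr_ge0 // ltW.
  have LL : 1 <= L (x + e) + L x by rewrite -natrD ler1n.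
  rewrite subr_sqr normrM (ger0_norm (_ : 0 <= W (x + e) + W x)); last first.
    by rewrite addr_ge0 // ltW.
  set S := W (x + e) + W x; set Z := `|_|.
  have -> : (W (x + e) - W x) ^+ 2 = Z ^+ 2 by rewrite /Z real_normK ?num_real.
  (* With one of the two sites visited, V + V' >= 1, so S^2 <= 2 (L + L' + 1), and L + L' >= 1
     absorbs the constant. *)
  have S2 : S ^+ 2 <= 4 * (L (x + e) + L x).
    have s1 := WE (x + e); have s2 := WE x; have s3 := sqr_ge0 (W (x + e) - W x).
    have -> : S ^+ 2 = 2 * W (x + e) ^+ 2 + 2 * W x ^+ 2 - (W (x + e) - W x) ^+ 2.
      by rewrite /S; ring.
    have [/andP[v1 _] _] := VL x; have [/andP[v2 _] _] := VL (x + e).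
    have : 1 <= V x + V (x + e).
      move: n0 v1 v2; rewrite addn_gt0 /V => /orP[] -> /=; lra.
    lra.
  have : Z * S <= l / 2 * Z ^+ 2 + 2^-1 / l * S ^+ 2.
    rewrite -subr_ge0 (_ : _ - _ = 2^-1 / l * (l * Z - S) ^+ 2); last first.
      by field; rewrite gt_eqF.
    by rewrite mulr_ge0 ?sqr_ge0 // divr_ge0 // ltW.
  move=> h; apply: le_trans h _; rewrite lerD2l.
  have -> : 2 / l * (L (x + e) + L x) = 2^-1 / l * (4 * (L (x + e) + L x)) by field; rewrite gt_eqF.
  by rewrite ler_wpM2l // divr_ge0 // ltW.
apply: le_trans (lerD key (lexx (V (x + e) + V x))).
rewrite !WE.
have [/andP[v1 _] _] := VL x; have [/andP[v2 _] _] := VL (x + e).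
rewrite (_ : L (x + e) - L x = (L (x + e) + 1 - V (x + e) - (L x + 1 - V x)) + (V (x + e) - V x)); last by ring.
apply: le_trans (ler_normD _ _) _; rewrite lerD2l ler_norml; lra.
Qed.

Variables (t Delta : R) (t_gt0 : 0 < t).
Hypothesis B0 : (0 < #|B|)%N.
Hypothesis hDelta : forall y, tv (fun x => (occ q x)%:R) (b y) <= Delta.

Notation a := ((#|B|%:R)^-1 : R).
Notation w := (clamp (smeared b q) a t).

(** Subtracting sqrt t inside the square leaves the increments of the square root equal to those of
    the clamp, while the support shrinks to the sites where the average exceeds t. *)
Definition profile (x : G) : R := (clamp (smeared b q) a t x - Num.sqrt t) ^+ 2.

Let z (x : G) : R := a * (occ (smeared b q) x)%:R.
Let L (x : G) : R := (occ q x)%:R.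

Let a_gt0 : 0 < a. Proof. by rewrite invr_gt0 ltr0n. Qed.
Let z_ge0 x : 0 <= z x. Proof. by rewrite mulr_ge0 // ltW. Qed.
Let fz : finsupp z. Proof. by apply: finsuppMl; exact: finsupp_occ. Qed.
Let fL : finsupp L. Proof. exact: finsupp_occ. Qed.

Lemma zsum_smeared : zsum z = #|I|%:R.
Proof.
by rewrite zsumMl zsum_occ1 card_prod natrM mulrCA mulVf ?mulr1 // pnatr_eq0 -lt0n.
Qed.

(** z is the mean of the translates of L by the box points, so the triangle inequality leaves the
    mean of their total variations. *)
Lemma smeared_dist : zsum (fun x => `|z x - L x|) <= Delta.
Proof.
have zE x : z x - L x = a * \sum_y (L (x - b y) - L x).
  rewrite sumrB mulrBr; congr (_ - _); last first.
    by rewrite sumr_const -[L x *+ _]mulr_natl mulrA mulVf ?mul1r // pnatr_eq0 -lt0n.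
  rewrite /z /L; congr (_ * _); rewrite occE.
  rewrite -(pair_bigA _ (fun i y => (smeared b q (i, y) == x)%:R : R)) exchange_big /=.
  apply: eq_bigr => y _; rewrite occE; apply: eq_bigr => i _.
  by rewrite /smeared /= -subr_eq opprK.
have fd y : finsupp (fun x => `|L (x - b y) - L x|) by exact: finsupp_tv.
have [fs es] := zsum_sum (index_enum B) fd.
apply: (@le_trans _ _ (zsum (fun x => a * \sum_y `|L (x - b y) - L x|))).
  apply: le_zsum; first exact: finsuppB_norm.
    exact: finsuppMl.
  move=> x; rewrite zE normrM (gtr0_norm a_gt0) ler_pM2l //; exact: ler_norm_sum.
rewrite zsumMl es mulrC ler_pdivrMr ?ltr0n //.
rewrite mulrC -sumr_const mulr_suml; apply: ler_sum => y _.
by rewrite mul1r -/(tv L (- b y)) tvN; exact: hDelta.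
Qed.

Lemma profile_cases x :
  (z x <= t /\ profile x = 0 /\ w x = Num.sqrt t) \/
  (t < z x /\ Num.sqrt t < w x /\ w x ^+ 2 = z x).
Proof.
rewrite /profile; case: (leP (z x) t) => h; [left|right].
  have wE : w x = Num.sqrt t by rewrite /clamp max_r.
  by rewrite wE subrr expr0n.
have wE : w x ^+ 2 = z x by rewrite clamp_sqr // max_l // ltW.
split=> //; split=> //; rewrite /clamp ltr_sqrt ?lt_max ?h // .
by rewrite (lt_trans t_gt0 h).
Qed.

Lemma finsupp_profile : finsupp profile.
Proof.
apply: (@finsupp_clamp _ _ _ _ _ _ t_gt0 (fun y => (y - Num.sqrt t) ^+ 2)).
by rewrite subrr expr0n.
Qed.

(** Above the threshold the loss is 2 w sqrt t - t <= l w^2 + t/l, by completing the square. At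
    unvisited sites profile <= z = |z - L| already holds, so t/l is paid only on visited sites. *)
Lemma profile_dist (l : R) : 0 < l <= 1 ->
  zsum (fun x => `|profile x - L x|) <= Delta + l * #|I|%:R + t / l * nsites%:R.
Proof.
case/andP=> l0 l1.
have fV := finsupp_visited.
have fd : finsupp (fun x => `|z x - L x|) by exact: finsuppB_norm.
apply: (@le_trans _ _ (zsum (fun x => (`|z x - L x| + l * z x) + t / l * (0 < occ q x)%N%:R))).
  apply: le_zsum.
  - by apply: finsuppB_norm => //; exact: finsupp_profile.
  - by apply: finsuppD; [apply: finsuppD => //|]; exact: finsuppMl.
  move=> x; have zx := z_ge0 x.
  have tl : t <= t / l by rewrite ler_pdivlMr // ler_piMr // ltW.
  have s0 : 0 < Num.sqrt t by rewrite sqrtr_gt0.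
  have st : Num.sqrt t ^+ 2 = t by rewrite sqr_sqrtr // ltW.
  have p_le : 0 <= profile x <= z x.
    rewrite sqr_ge0 /=; case: (profile_cases x) => [[_ [-> _]] //|[_ [ws <-]]].
    by rewrite /profile; nra.
  have gap : z x - profile x <= l * z x + t / l.
    case: (profile_cases x) => [[zt [-> _]]|[_ [ws <-]]].
      by have : 0 <= l * z x; [rewrite mulr_ge0 // ltW | lra].
    rewrite /profile -subr_ge0.
    have -> : l * w x ^+ 2 + t / l - (w x ^+ 2 - (w x - Num.sqrt t) ^+ 2) =
        l * (w x - Num.sqrt t / l) ^+ 2 + Num.sqrt t ^+ 2.
      by rewrite -[in t / l]st; field; rewrite gt_eqF.
    by rewrite addr_ge0 ?sqr_ge0 // mulr_ge0 ?sqr_ge0 // ltW.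
  case: (posnP (occ q x)) => [no0|no1]; rewrite /=.
    rewrite /L no0 !subr0 ?ltnn mulr0 addr0 !ger0_norm //; last by case/andP: p_le.
    by case/andP: p_le => p0 pz; apply: (le_trans pz); rewrite lerDl mulr_ge0 // ltW.
  rewrite mulr1 -addrA.
  rewrite (_ : profile x - L x = (z x - L x) - (z x - profile x)); last by ring.
  apply: le_trans (ler_normB _ _) _; rewrite lerD2l ger0_norm //.
  by rewrite subr_ge0; case/andP: p_le.
rewrite (zsumD (finsuppD fd (finsuppMl l fz)) (finsuppMl (t / l) fV)).
rewrite (zsumD fd (finsuppMl l fz)) (zsumMl l z) (zsumMl (t / l)) zsum_smeared zsum_visited.
by rewrite !lerD2r smeared_dist.
Qed.

Lemma finsupp_profile_gt0 : finsupp (fun x => (0 < profile x)%R%:R : R).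
Proof.
apply: (finsupp_dom finsupp_profile) => x ->; by rewrite ltxx.
Qed.

(** Markov's inequality: at an unvisited site of the support L = 0 and z > t, so |z - L| exceeds t
    there. *)
Lemma profile_support :
  zsum (fun x => (0 < profile x)%R%:R) <= nsites%:R + Delta / t.
Proof.
have fV := finsupp_visited.
have fd : finsupp (fun x => `|z x - L x|) by exact: finsuppB_norm.
apply: (@le_trans _ _ (zsum (fun x => (0 < occ q x)%N%:R + t^-1 * `|z x - L x|))).
  apply: le_zsum; first exact: finsupp_profile_gt0.
    by apply: finsuppD => //; exact: finsuppMl.
  move=> x; have d0 : 0 <= t^-1 * `|z x - L x| by rewrite mulr_ge0 // invr_ge0 ltW.
  case: (posnP (occ q x)) => [no0|no1] /=; last by case: (0 < profile x) => /=; lra.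
  case: (profile_cases x) => [[_ [-> _]]|[tz _]].
    by rewrite ltxx add0r.
  rewrite add0r /L no0 subr0 ger0_norm //.
  apply: (@le_trans _ _ 1); first by case: (0 < _).
  by rewrite mulrC ler_pdivlMr // mul1r ltW.
rewrite zsumD //; last exact: finsuppMl.
rewrite zsumMl zsum_visited lerD2l mulrC ler_pM2r ?invr_gt0 //; exact: smeared_dist.
Qed.
End Profile.

(** * Unit steps, boxes and the Dirichlet sum on the integer lattice *)

Section Lattice.
Context {R : realType} {d : nat}.

Definition axis (j : 'I_d) : 'I_(2 * d) := widen_ord (leq_pmull d (isT : 0 < 2)%N) j.

Lemma step_axis (j : 'I_d) : step_vec (axis j) = delta_mx ord0 j.
Proof.
apply/rowP => i; rewrite !mxE eqxx /=.
have [->|ij] := eqVneq i j; first by rewrite eqxx.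
have -> : (j == i :> nat) = false by apply/negbTE; rewrite eq_sym.
by rewrite ltn_eqF // (leq_trans (ltn_ord j)) // leq_addl.
Qed.

Lemma step_cases (k : 'I_(2 * d)) :
  exists j : 'I_d, step_vec k = delta_mx ord0 j \/ step_vec k = - delta_mx ord0 j.
Proof.
have [kd|dk] := ltnP k d.
  exists (Ordinal kd); left; rewrite -step_axis; congr step_vec; exact/val_inj.
have kd : (k - d < d)%N by rewrite ltn_subLR // addnn -mul2n.
exists (Ordinal kd); right; apply/rowP => i; rewrite !mxE eqxx /=.
rewrite gtn_eqF; last exact: leq_trans (ltn_ord i) dk.
rewrite -val_eqE /= [RHS](_ : _ = if (k : nat) == (i + d)%N then -1 else 0) //.
by rewrite -{2}(subnK dk) eqn_add2r eq_sym; case: eqP.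
Qed.

Lemma adj_step (y z : Zd d) : adj y z -> exists k, z = y + step_vec k.
Proof.
move=> /eqP h.
have [j hj|none] := pickP (fun j => y ord0 j - z ord0 j != 0); last first.
  move: h; rewrite big1 // => i _; have := none i.
  by move=> /negbFE /eqP ->; rewrite normr0.
move: h; rewrite (bigD1 j) //= => h.
have rest0 : 0 <= \sum_(i < d | i != j) `|y ord0 i - z ord0 i| by apply: sumr_ge0.
have n1 : 1 <= `|y ord0 j - z ord0 j| by rewrite -gtz0_ge1 normr_gt0.
have yj : `|y ord0 j - z ord0 j| = 1.
  by apply/eqP; rewrite eq_le n1 andbT -h lerDl.
have /eqP : \sum_(i < d | i != j) `|y ord0 i - z ord0 i| = 0.
  by apply: (addrI 1); rewrite addr0 -{1}yj.
rewrite psumr_eq0 // => /allP all0.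
have same i : i != j -> z ord0 i = y ord0 i.
  move=> ij; have /implyP /(_ ij) := all0 i (mem_index_enum _).
  by rewrite normr_eq0 subr_eq0 => /eqP.
have [e|e] : z ord0 j = y ord0 j + 1 \/ z ord0 j = y ord0 j - 1 by lia.
  exists (axis j); apply/rowP => i; rewrite mxE step_axis mxE eqxx /=.
  by case: (i =P j) => [->|/eqP /same ->]; rewrite ?addr0.
have jd : (j + d < 2 * d)%N by rewrite mul2n -addnn ltn_add2r.
exists (Ordinal jd); apply/rowP => i; rewrite !mxE /= gtn_eqF; last first.
  by rewrite (leq_trans (ltn_ord i)) // leq_addl.
rewrite eqn_add2r; case: (i =P j) => [->|/eqP ne].
  by rewrite eqxx e.
by rewrite [X in if X then _ else _](negbTE _) ?addr0 ?same // eq_sym.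
Qed.

(** Each adjacent ordered pair has the form (x, x + e), so the edge sum is covered by one site sum
    per step. An upper bound on the rate calls for this direction. *)
Lemma dirichlet_le (f : Zd d -> R) :
  (forall e, finsupp (fun x => (f (x + step_vec e) - f x) ^+ 2)) ->
  (dirichlet f <=
   ((2 * d)%:R^-1 * \sum_e zsum (fun x => (f (x + step_vec e) - f x) ^+ 2))%:E)%E.
Proof.
move=> fin; rewrite /dirichlet EFinM; apply: lee_wpmul2l.
  by rewrite lee_fin invr_ge0 ler0n.
pose g (p : Zd d * Zd d) : \bar R := ((f p.1 - f p.2) ^+ 2)%:E.
have g0 p : (0 <= g p)%E by rewrite lee_fin sqr_ge0.
pose F (p : Zd d * Zd d) e : \bar R := if p.2 == p.1 + step_vec e then g p else 0%E.
have F0 p e : (0 <= F p e)%E by rewrite /F; case: ifP.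
have step1 : (\esum_(p in [set p : Zd d * Zd d | adj p.1 p.2]) g p <=
    \esum_(p in [set: Zd d * Zd d]) \sum_e F p e)%E.
  rewrite esum_mkcond; apply: le_esum => -[x y] _.
  case: ifPn => [|_]; last exact: sume_ge0.
  rewrite inE /= => /adj_step[e ->].
  rewrite (bigD1 e) //= /F eqxx -[leLHS]adde0; apply: leeD => //.
  by apply: sume_ge0 => e' _; case: ifP.
apply: (le_trans step1); rewrite -sumEFin.
rewrite esum_sum //.
apply: lee_sum => e _.
rewrite -(esum_zsum (fin e)); last by move=> x; exact: sqr_ge0.
rewrite (eq_esum (b := fun p => if p \in [set p | p.2 = p.1 + step_vec e] then g p else 0%E)); last first.
  by move=> p _; congr (if _ then _ else _); apply/eqP/idP; rewrite inE.
rewrite -esum_mkcond.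
rewrite (@reindex_esum R _ _ [set: Zd d] [set p | p.2 = p.1 + step_vec e] (fun x => (x, x + step_vec e))); last first.
  by split; [move=> x _ | move=> x y _ _ [] | move=> [x y] /= ->; exists x].
apply: le_esum => x _; rewrite /g /= lee_fin.
by rewrite -[leLHS]sqrrN opprB.
Qed.

Variable M : nat.

Definition box (y : {ffun 'I_d -> 'I_M}) : Zd d := \row_j (y j : nat)%:Z.

Lemma box_inj : injective box.
Proof.
move=> y y' /rowP h; apply/ffunP => j; apply/val_inj.
by have := h j; rewrite !mxE => -[].
Qed.

Lemma box_sum y : box y = \sum_j step_vec (axis j) *+ (y j).
Proof.
apply/rowP => i; rewrite summxE (bigD1 i) //= big1 => [|j ji].
  by rewrite step_axis addr0 mulmxnE !mxE !eqxx -[RHS]mulr_natl mulr1 natz.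
rewrite step_axis mulmxnE mxE eqxx /= [_ == _]eq_sym (negbTE ji).
by rewrite mul0rn.
Qed.

Lemma tv_box (F : Zd d -> R) (T : R) y : finsupp F ->
  (forall j, tv F (step_vec (axis j)) <= T) -> 0 <= T ->
  tv F (box y) <= d%:R * M%:R * T.
Proof.
move=> f hT T0; rewrite box_sum; apply: le_trans (tv_sum _ _ f) _.
have -> : d%:R * M%:R * T = \sum_(j < d) M%:R * T.
  by rewrite sumr_const card_ord -[RHS]mulr_natl mulrA.
apply: ler_sum => j _; apply: le_trans (tvMn _ _ f) _.
rewrite -[leLHS]mulr_natl; apply: (@le_trans _ _ ((y j)%:R * T)).
  by rewrite ler_wpM2l // ler0n.
by rewrite ler_wpM2r // ler_nat ltnW.
Qed.

(** Written with the factor M to avoid the exponent d - 1; the indicator of the face is a product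
    over coordinates. *)
Lemma card_face (j : 'I_d) (c : 'I_M) :
  (M * #|{: {y : {ffun 'I_d -> 'I_M} | y j == c}}|)%N = (M ^ d)%N.
Proof.
rewrite card_sig -sum1_card big_mkcond /=.
rewrite (eq_bigr (fun y : {ffun 'I_d -> 'I_M} =>
  \prod_i (if i == j then (y i == c : nat) else 1%N)))%N; last first.
  move=> y _; rewrite (bigD1 j) //= eqxx big1 ?muln1; last first.
    by move=> i /negbTE ->.
  by rewrite inE; case: (y j == c).
rewrite -(bigA_distr_bigA (fun i k => if i == j then (k == c : nat) else 1%N)) /=.
rewrite (bigD1 j) //= eqxx (bigD1 c) //= eqxx big1 ?addn0 ?mul1n; last first.
  by move=> k /negbTE ->.
rewrite (eq_bigr (fun=> M)); last first.
  by move=> i /negbTE ->; rewrite sum1_card card_ord.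
rewrite prod_nat_const -expnS; congr expn.
have := cardC1 j; rewrite card_ord => h.
have -> : #|[pred i | i != j]| = d.-1 by rewrite -h; apply: eq_card => i; rewrite !inE.
by rewrite prednK // (leq_ltn_trans _ (ltn_ord j)).
Qed.

(* Only the two faces of the box orthogonal to the shift contribute. *)
Lemma box_boundary (e : 'I_(2 * d)) : (0 < M)%N ->
  (#|{ffun 'I_d -> 'I_M}|%:R)^-1 *
  zsum (fun z => `|(occ box (z - step_vec e))%:R - (occ box z)%:R| : R) <= 2 / M%:R.
Proof.
move=> M0; rewrite -/(tv (fun z => (occ box z)%:R) (- step_vec e)) tvN.
have [j ->] : exists j : 'I_d, tv (fun z => (occ box z)%:R : R) (step_vec e) =
    tv (fun z => (occ box z)%:R : R) (delta_mx ord0 j).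
  by have [j [->|->]] := step_cases e; exists j; rewrite ?tvN.
set u : Zd d := delta_mx ord0 j.
pose c0 : 'I_M := Ordinal M0.
have M1 : (M.-1 < M)%N by rewrite prednK.
pose c1 : 'I_M := Ordinal M1.
(* If z + u is in the box and z is not, then z + u is on the first face ([p0]); if z is in the box
   and z + u is not, then z is on the last face ([p1]). *)
pose p0 (y : {y : {ffun 'I_d -> 'I_M} | y j == c0}) := box (val y) - u.
pose p1 (y : {y : {ffun 'I_d -> 'I_M} | y j == c1}) := box (val y).
have occ01 z : occ box z = (z \in codom box) :> nat.
  by rewrite -occ_gt0; case: (occ box z) (occ_inj_le1 z box_inj) => [|[]].
have upd (y : {ffun 'I_d -> 'I_M}) (c : 'I_M) (s : int) : c%:Z = (y j)%:Z + s ->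
    box y + s *: u \in codom box.
  move=> hc; apply/codomP; exists [ffun i => if i == j then c else y i].
  apply/rowP => i; rewrite !mxE ffunE eqxx /=.
  by case: (i =P j) => [->|_]; rewrite ?hc ?mulr1 ?mulr0 ?addr0.
have pw z : `|(occ box (z + u))%:R - (occ box z)%:R| <= (occ p0 z)%:R + (occ p1 z)%:R :> R.
  rewrite !occ01; case: (boolP (z + u \in _)) => [/codomP[y hy]|h1];
    case: (boolP (z \in _)) => [hz|hz]; rewrite ?subrr ?normr0 ?addr_ge0 ?ler0n //=.
    rewrite subr0 normr1 -natrD ler1n addn_gt0 occ_gt0.
    have [yc|yc] := eqVneq (y j) c0.
      apply/orP; left; apply/codomP; exists (Sub y (introT eqP yc)).
      by rewrite /p0 /= -hy addrK.
    case/negP: hz; have yj : (0 < y j)%N by rewrite lt0n; apply: contra yc => /eqP h; apply/eqP/val_inj.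
    have lt : ((y j).-1 < M)%N by rewrite prednK // ltnW.
    have := upd y (Ordinal lt) (-1); rewrite scaleN1r -hy addrK; apply.
    by rewrite -[in RHS](prednK yj) -addn1 PoszD addrK.
  rewrite sub0r normrN normr1 -natrD ler1n addn_gt0 !occ_gt0.
  case/codomP: hz => y hy.
  have [yc|yc] := eqVneq (y j) c1.
    by apply/orP; right; apply/codomP; exists (Sub y (introT eqP yc)).
  case/negP: h1.
  have lt : ((y j).+1 < M)%N.
    have := ltn_ord (y j); have : (y j : nat) != M.-1 by apply: contra yc => /eqP h; apply/eqP/val_inj.
    by lia.
  have := upd y (Ordinal lt) 1; rewrite scale1r -hy; apply.
  by rewrite /=; lia.
have le1 : tv (fun z => (occ box z)%:R) u <= (#|{: {y : {ffun 'I_d -> 'I_M} | y j == c0}}|%:R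
    + #|{: {y : {ffun 'I_d -> 'I_M} | y j == c1}}|%:R : R).
  rewrite -(zsum_occ1 p0) -(zsum_occ1 p1) -zsumD; try exact: finsupp_occ.
  apply: le_zsum => //; first exact/finsupp_tv/finsupp_occ.
  by apply: finsuppD; exact: finsupp_occ.
rewrite card_ffun !card_ord.
have Md : 0 < (M ^ d)%:R :> R by rewrite ltr0n expn_gt0 M0.
rewrite mulrC ler_pdivrMr // mulrAC ler_pdivlMr ?ltr0n //.
apply: le_trans (ler_wpM2r (ler0n _ _) le1) _.
by rewrite mulrDl -!natrM ![(_ * M)%N]mulnC !card_face -natrD addnn -mul2n.
Qed.

Variable N : nat.

(** The cube [-N, N + M]^d contains the positions of the walk and their translates by box points;
    its cardinality governs both entropy counts. *)
Definition candidate (g : {ffun 'I_d -> 'I_(2 * N + M).+1}) : Zd d :=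
  \row_j ((g j : nat)%:Z - N%:Z).

Lemma candidate_inj : injective candidate.
Proof.
move=> y y' /rowP h; apply/ffunP => j; apply/val_inj.
have := h j; rewrite !mxE /= => /addIr h'; by case: h'.
Qed.

Lemma candidate_codom (x : Zd d) : (forall j, - N%:Z <= x ord0 j <= N%:Z + M%:Z) ->
  x \in codom candidate.
Proof.
move=> hx; apply/codomP; exists [ffun j => inord (absz (x ord0 j + N%:Z))].
have e0 j : x 0 j = x ord0 j by congr (x _ j); exact/val_inj.
apply/rowP => j; move: (hx j); rewrite mxE ffunE e0.
by move: (x ord0 j) => v hv; rewrite inordK; lia.
Qed.

Lemma pos_bound (s : walk d N) k j : - N%:Z <= pos s k ord0 j <= N%:Z.
Proof.
rewrite -ler_norml /pos summxE; apply: le_trans (ler_norm_sum _ _ _) _.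
apply: (@le_trans _ _ (\sum_(i < N) 1)); last by rewrite sumr_const card_ord natz.
rewrite big_mkcond; apply: ler_sum => i _; case: ifP => // _.
by rewrite mxE; case: ifP => // _; case: ifP.
Qed.

Lemma pos_codom (s : walk d N) k : pos s k \in codom candidate.
Proof.
apply: candidate_codom => j; have := pos_bound s k j.
by move: (pos s k ord0 j) => v; lia.
Qed.

Lemma smeared_codom (s : walk d N) z :
  smeared box (fun k : 'I_N => pos s k) z \in codom candidate.
Proof.
apply: candidate_codom => j; have := pos_bound s z.1 j.
have -> : smeared (@box) (fun k : 'I_N => pos s k) z ord0 j =
    pos s z.1 ord0 j + (z.2 j : nat)%:Z by rewrite /smeared mxE [box _ _ _]mxE.
have := ltn_ord (z.2 j); move: (nat_of_ord (z.2 j)) (pos s z.1 ord0 j) => m v; lia.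
Qed.

Lemma loctime_occ (s : walk d N) x : loctime s x = occ (fun k : 'I_N => pos s k) x.
Proof.
rewrite /loctime /occ; apply: eq_card => k.
by apply/idP/idP => [/set_mem|h] //; apply: mem_set.
Qed.

(** Only an inequality: local times count the times below N, the range also the endpoint. *)
Lemma nsites_range (s : walk d N) :
  (nsites (fun k : 'I_N => pos s k) <= range_card s)%N.
Proof.
apply: uniq_leq_size; first exact: undup_uniq.
move=> x; rewrite !mem_undup => /codomP[k ->]; apply/map_f.
by rewrite mem_iota /= add0n ltnS ltnW.
Qed.
End Lattice.

(** * Union bound over a finite class of test functions *)

Section UnionBound.
Context {R : realType} {G : zmodType} {K : finType} (st : K -> G).
Hypothesis K0 : (0 < #|K|)%N.

(** The maximum over the class is replaced by the sum of the martingales. The normalization 1 <= u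
    allows the terminal factor u(S_N) to be dropped; the initial value u(0) is paid through [A]. *)
Lemma walk_union_bound N (T : finType) (u : T -> G -> R) (A : R)
    (P : pred {ffun 'I_N -> K}) (f : {ffun 'I_N -> K} -> R) :
  (forall tau x, 1 <= u tau x) -> (forall tau, u tau 0 <= A) ->
  (forall s, P s -> exists tau, f s <=
     \sum_(k < N) (1 - wmean st (u tau) (wpos st s k) / u tau (wpos st s k))) ->
  \sum_(s | P s) expR (f s) <= #|T|%:R * (#|K|%:R ^+ N * A).
Proof.
move=> u1 uA hf.
have u0 tau x : 0 < u tau x by apply: lt_le_trans (u1 tau x).
pose g tau (s : {ffun 'I_N -> K}) :=
  \prod_(k < N) (u tau (wpos st s k) / wmean st (u tau) (wpos st s k)) * u tau (wpos st s N).
have g0 tau s : 0 <= g tau s.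
  rewrite mulr_ge0 ?(ltW (u0 _ _)) // prodr_ge0 // => k _.
  by rewrite divr_ge0 ?ltW // wmean_gt0.
apply: (@le_trans _ _ (\sum_s \sum_tau g tau s)).
  rewrite big_mkcond; apply: ler_sum => s _.
  case: ifP => [/hf[tau ht]|_]; last exact: sumr_ge0.
  rewrite (bigD1 tau) //= -[leLHS]addr0 lerD ?sumr_ge0 //.
  apply: (@le_trans _ _ (expR (\sum_(k < N)
    (1 - wmean st (u tau) (wpos st s k) / u tau (wpos st s k))))).
    by rewrite ler_expR.
  apply: le_trans (prod_ge_expR st s K0 (u0 tau)) _.
  rewrite /g ler_peMr // prodr_ge0 // => k _.
  by rewrite divr_ge0 ?ltW // wmean_gt0.
rewrite exchange_big /= -sumr_const mulr_suml; apply: ler_sum => tau _.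
by rewrite mul1r walk_martingale // ler_wpM2l // exprn_ge0.
Qed.
End UnionBound.

(** * Exponential moment of the energy of the raw local time *)

Section RoughEnergy.
Context {R : realType} {G : zmodType} {K C : finType} (st : K -> G) (pt : C -> G).
Hypothesis K0 : (0 < #|K|)%N.

(** For the 2d unit steps this is half the Dirichlet form of the clamped field, matching the factor
    N/2 of the rate. *)
Definition energy {I : finType} (p : I -> G) (a t : R) : R :=
  (2 * #|K|%:R)^-1 *
  \sum_e zsum (fun x => (clamp p a t (x + st e) - clamp p a t x) ^+ 2).

Lemma energy_step_le {I : finType} (p : I -> G) (a t : R) e :
  zsum (fun x => (clamp p a t (x + st e) - clamp p a t x) ^+ 2) <=
  2 * #|K|%:R * energy p a t.
Proof.
rewrite /energy mulVKf ?mulf_neq0 ?pnatr_eq0 -?lt0n //.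
rewrite (bigD1 e) //= lerDl sumr_ge0 // => e' _.
by apply: zsum_ge0 => x; exact: sqr_ge0.
Qed.

Lemma energy_le_mean {I : finType} (p : I -> G) (t : R) : 0 < t ->
  energy p 1 t <= \sum_i (1 - wmean st (clamp p 1 t) (p i) / clamp p 1 t (p i)).
Proof.
move=> t0; set w := clamp p 1 t.
have nK : 0 < #|K|%:R :> R by rewrite ltr0n.
have -> : \sum_i (1 - wmean st w (p i) / w (p i)) =
    #|K|%:R^-1 * \sum_e \sum_i (1 - w (p i + st e) / w (p i)).
  rewrite exchange_big /= mulr_sumr; apply: eq_bigr => i _.
  rewrite sumrB sumr_const mulrBr -[1 *+ _]mulr_natl mulr1 mulVf ?gt_eqF //.
  by rewrite /wmean -mulrA mulr_suml.
rewrite /energy invfM -mulrA mulrCA ler_pM2l ?invr_gt0 // mulr_sumr.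
apply: ler_sum => e _; rewrite -[leRHS]mul1r; exact: clamp_energy_step.
Qed.

(* These weights are indexed by Q pairs (site, local time), which is enough to
   record sqrt(max(L_N, 1)) for a walk visiting at most Q sites. *)
Definition listed_weight (Q N : nat) (tau : {ffun 'I_Q -> C * 'I_N.+1}) (x : G) : R :=
  Num.sqrt (Num.max (\sum_i (tau i).2%:R * (pt (tau i).1 == x)%:R) 1).

Lemma listed_clamp (I : finType) (q : I -> G) (Q N : nat) (g0 : C) :
  (nsites q <= Q)%N -> (#|I| <= N)%N -> (forall i, q i \in codom pt) ->
  exists tau : {ffun 'I_Q -> C * 'I_N.+1}, forall x, clamp q 1 1 x = listed_weight tau x.
Proof.
move=> hQ hN hc; set r := undup (codom q).
pose pick_pt x : C := odflt g0 [pick g | pt g == x].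
have pickK x : x \in r -> pt (pick_pt x) = x.
  rewrite mem_undup => /codomP[i ->]; rewrite /pick_pt; case: pickP => [g /eqP //|none].
  by have /codomP[g hg] := hc i; have := none g; rewrite hg eqxx.
have occN x : (occ q x < N.+1)%N.
  by rewrite ltnS (leq_trans _ hN) // max_card.
(* Entries beyond the visited sites get local time [ord0], so the padding adds nothing to the
   weight. *)
exists [ffun i : 'I_Q => (pick_pt (nth 0 r i),
  if (i < size r)%N then Ordinal (occN (nth 0 r i)) else ord0)] => x.
rewrite /clamp /listed_weight; congr (Num.sqrt (Num.max _ _)); rewrite mul1r.
rewrite (eq_bigr (fun i : 'I_Q => if (i < size r)%N then
   (occ q (nth 0 r i))%:R * (nth 0 r i == x)%:R else 0)); last first.
  move=> i _; rewrite ffunE /=; case: ifP => [ir|_]; last by rewrite mul0r.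
  by rewrite pickK // mem_nth.
rewrite -big_mkcond /= -(big_ord_widen _ (fun i => (occ q (nth 0 r i))%:R * (nth 0 r i == x)%:R) hQ).
rewrite -(big_mkord xpredT (fun i => (occ q (nth 0 r i))%:R * (nth 0 r i == x)%:R)).
rewrite -(big_nth 0 xpredT (fun y => (occ q y)%:R * (y == x)%:R)).
case: (boolP (x \in r)) => xr.
  rewrite (bigD1_seq x) ?undup_uniq //= eqxx mulr1 big1 ?addr0 // => y /negbTE ->.
  exact: mulr0.
rewrite occ0; last by rewrite -mem_undup.
rewrite big_seq big1 // => y yr.
by have [e|_] := eqVneq y x; [rewrite e (negbTE xr) in yr | exact: mulr0].
Qed.

Lemma rough_energy_moment (Q N : nat) (g0 : C) (P : pred {ffun 'I_N -> K}) :
  (forall s, P s -> (nsites (fun k : 'I_N => wpos st s k) <= Q)%N) ->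
  (forall (s : {ffun 'I_N -> K}) (k : 'I_N), wpos st s k \in codom pt) ->
  \sum_(s | P s) expR (energy (fun k : 'I_N => wpos st s k) 1 1) <=
  ((#|C| * N.+1) ^ Q)%:R * (#|K|%:R ^+ N * (Q * N).+1%:R).
Proof.
move=> hP hc.
have -> : ((#|C| * N.+1) ^ Q)%N = #|{: {ffun 'I_Q -> C * 'I_N.+1}}|.
  by rewrite card_ffun card_prod !card_ord.
have ge1 (tau : {ffun 'I_Q -> C * 'I_N.+1}) x : 1 <= listed_weight tau x.
  by rewrite -[leLHS]sqrtr1 ler_wsqrtr // le_max lexx orbT.
apply: (walk_union_bound K0 (u := @listed_weight Q N)) => // [tau|s Ps].
  have h1 : 1 <= (Q * N).+1%:R :> R by rewrite ler1n.
  have h2 : Num.max (\sum_i (tau i).2%:R * (pt (tau i).1 == 0)%:R) 1 <= (Q * N).+1%:R :> R.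
    rewrite ge_max h1 andbT; apply: (@le_trans _ _ (\sum_(i < Q) N%:R)).
      apply: ler_sum => i _; rewrite -[leRHS]mulr1.
      by rewrite ler_pM ?ler0n //; [rewrite ler_nat -ltnS | rewrite lern1 leq_b1].
    by rewrite sumr_const card_ord -mulrnA ler_nat mulnC leqnSn.
  apply: le_trans (ler_wsqrtr h2) _.
  rewrite -[leRHS]ger0_norm // -sqrtr_sqr ler_wsqrtr //.
  by rewrite expr2 ler_peMl.
have [tau ht] := @listed_clamp _ (fun k : 'I_N => wpos st s k) Q N g0 (hP s Ps) (eq_leq (card_ord N)) (hc s).
exists tau; apply: le_trans (energy_le_mean _ ltr01) _.
have -> : clamp (fun k : 'I_N => wpos st s k) 1 1 = listed_weight tau by apply/funext.
exact: lexx.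
Qed.
End RoughEnergy.

(** * Exponential moment of the smoothed energy *)

Section SmoothEnergy.
Context {R : realType} {G : zmodType} {K B C : finType}.
Context (st : K -> G) (b : B -> G) (pt : C -> G).

Lemma sample_weight_bounds (c : R) (Q : nat) (tau : {ffun 'I_Q -> option C}) x :
  injective b -> 0 <= c -> (0 < #|B|)%N ->
  1 <= sample_weight b pt c tau x <= expR (c * Q%:R / #|B|%:R).
Proof.
move=> ib c0 B0; have m0 : 0 <= (#|B|%:R)^-1 :> R by rewrite invr_ge0.
have occ1 z : (occ b z <= 1)%N by exact: occ_inj_le1.
apply/andP; split.
  rewrite -expR0 ler_expR sumr_ge0 // => i _; case: (tau i) => [g|] //=.
  by rewrite !mulr_ge0.
rewrite ler_expR (_ : _ / _ = \sum_(i < Q) c * (#|B|%:R)^-1); last first.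
  by rewrite sumr_const card_ord -[RHS]mulr_natl; ring.
apply: ler_sum => i _; case: (tau i) => [g|] /=; last by rewrite mulr_ge0.
by rewrite ler_wpM2l // ler_piMr // lern1.
Qed.

(** The loss 2 eta N of [smoothing_energy] is moved to the right before the union bound; the
    successor in the class size counts the draw [None]. *)
Lemma smooth_energy_moment (N Q : nat) (P : pred {ffun 'I_N -> K})
    (t c delta vmax eta : R) :
  (0 < #|K|)%N -> (0 < #|B|)%N -> 0 < t -> injective pt -> injective b ->
  let sm s := smeared b (fun k : 'I_N => wpos st s k) in
  (forall s z, sm s z \in codom pt) ->
  let v s x := ln (clamp (sm s) (#|B|%:R)^-1 t x / Num.sqrt t) : R in
  0 < c -> (0 < Q)%N -> c / #|B|%:R <= 2^-1 ->
  (forall s x, v s x <= vmax) -> (forall s, P s -> \sum_g v s (pt g) <= c * Q%:R) ->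
  (forall e, (#|B|%:R)^-1 * zsum (fun z => `|(occ b (z - st e))%:R - (occ b z)%:R| : R) <= delta) ->
  2 * c * vmax * delta / #|B|%:R <= eta -> 0 <= eta <= 2^-1 ->
  \sum_(s | P s) expR (energy st (sm s) (#|B|%:R)^-1 t) <=
  expR (2 * eta * N%:R) *
    ((#|C|.+1 ^ Q)%:R * (#|K|%:R ^+ N * expR (c * Q%:R / #|B|%:R))).
Proof.
move=> K0 B0 t0 ipt ib sm cov v c0 Q0 cB hv hQ hd heta eta2.
rewrite mulrC -ler_pdivrMr ?expR_gt0 // -expRN mulr_suml.
under eq_bigr do rewrite -expRD.
have -> : (#|C|.+1 ^ Q)%N = #|{: {ffun 'I_Q -> option C}}|.
  by rewrite card_ffun card_option card_ord.
apply: (walk_union_bound K0 (u := @sample_weight R G B C b pt c Q)).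
- by move=> tau x; have /andP[] := sample_weight_bounds tau x ib (ltW c0) B0.
- by move=> tau; have /andP[] := sample_weight_bounds tau 0 ib (ltW c0) B0.
move=> s Ps.
have [tau ht] := @smoothing_energy R G K B C 'I_N st b pt (fun k : 'I_N => wpos st s k)
  t c delta vmax eta Q K0 B0 t0 ipt ib (cov s) c0 Q0 cB (hv s) (hQ s Ps) hd heta eta2.
exists tau; rewrite card_ord in ht; exact: ht.
Qed.
End SmoothEnergy.

(** * The trial density attached to a walk *)

Section WalkProfile.
Context {R : realType} {d N M : nat}.
Hypothesis (d0 : (0 < d)%N) (N0 : (0 < N)%N) (M0 : (0 < M)%N).

Definition path_of (s : walk d N) (k : 'I_N) : Zd d := pos s k.

Definition rough_energy (s : walk d N) : R := energy (@step_vec d) (path_of s) 1 1.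

Definition smooth_energy (t : R) (s : walk d N) : R :=
  energy (@step_vec d) (smeared (@box d M) (path_of s)) (#|{ffun 'I_d -> 'I_M}|%:R)^-1 t.

Definition density (t : R) (s : walk d N) (x : Zd d) : R :=
  profile (path_of s) (@box d M) t x / N%:R.

Variables (s : walk d N) (t l Kp Q1 : R).
Hypothesis (t0 : 0 < t) (l0 : 0 < l).
Hypothesis (range_le : (range_card s)%:R <= Q1) (rough_le : rough_energy s <= Kp).

(* Bounds the l^1 distance between the local time and its average over boxes,
   for a walk with range at most Q1 and rough energy at most Kp. *)
Definition spread : R :=
  d%:R * M%:R * (l / 2 * (2 * (2 * d)%:R * Kp) + 4 / l * N%:R + 2 * Q1).

Let B0 : (0 < #|{ffun 'I_d -> 'I_M}|)%N.
Proof. by rewrite card_ffun !card_ord expn_gt0 M0. Qed.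

Let K0 : (0 < #|'I_(2 * d)|)%N.
Proof. by rewrite card_ord muln_gt0. Qed.

Let nsites_le : (nsites (path_of s))%:R <= Q1.
Proof. by apply: le_trans range_le; rewrite ler_nat; exact: nsites_range. Qed.

Lemma tv_box_spread (y : {ffun 'I_d -> 'I_M}) :
  tv (fun x => (occ (path_of s) x)%:R) (box y) <= spread.
Proof.
have step e : tv (fun x => (occ (path_of s) x)%:R) (step_vec e) <=
    l / 2 * (2 * (2 * d)%:R * Kp) + 4 / l * N%:R + 2 * Q1.
  apply: le_trans (tv_occ_le _ _ l0) _; rewrite card_ord !lerD //; last by rewrite ler_pM2l.
  rewrite ler_pM2l ?divr_gt0 //.
  apply: le_trans (energy_step_le (@step_vec d) K0 _ _ _ e) _.
  by rewrite card_ord ler_pM2l // mulr_gt0 // ltr0n muln_gt0.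
apply: tv_box => //; first exact: finsupp_occ.
by apply: le_trans (step (axis (Ordinal d0))); apply: zsum_ge0.
Qed.

Lemma density_ge0 x : 0 <= density t s x.
Proof. by rewrite /density divr_ge0 // sqr_ge0. Qed.

Lemma finsupp_density : finsupp (density t s).
Proof.
have f := finsupp_profile (path_of s) (@box d M) t0.
by apply: (finsupp_dom f) => x; rewrite /density => ->; rewrite mul0r.
Qed.

Lemma density_l1_fin : (l1norm (density t s) < +oo)%E.
Proof.
rewrite /l1norm esum_zsum ?ltry // .
by apply: (finsupp_dom finsupp_density) => x ->; rewrite normr0.
Qed.

Lemma density_l1_dist (lam : R) : 0 < lam <= 1 ->
  (l1norm (fun x => density t s x - fN s x ^+ 2 / N%:R)%R <=
   ((spread + lam * N%:R + t / lam * Q1) / N%:R)%:E)%E.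
Proof.
move=> hl; have nN : 0 < N%:R :> R by rewrite ltr0n.
pose F (x : Zd d) : R := N%:R^-1 * `|profile (path_of s) (@box d M) t x - (occ (path_of s) x)%:R|.
have fF : finsupp F.
  apply/finsuppMl/finsuppB_norm; [exact: finsupp_profile | exact: finsupp_occ].
rewrite /l1norm (eq_esum (b := fun x => (F x)%:E)); last first.
  move=> x _; congr EFin; rewrite /F /fN sqr_sqrtr // loctime_occ /density -mulrBl.
  by rewrite normrM mulrC normfV (gtr0_norm nN).
rewrite esum_zsum //; last by move=> x; rewrite mulr_ge0 // invr_ge0.
rewrite lee_fin zsumMl mulrC ler_pM2r ?invr_gt0 //.
apply: le_trans (profile_dist t0 B0 tv_box_spread hl) _.
rewrite card_ord lerD2l ler_pM2l // divr_gt0 //; by case/andP: hl.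
Qed.

Lemma density_supp : (supp_card (density t s) <= ((range_card s)%:R + spread / t)%:E)%E.
Proof.
have nN : 0 < N%:R :> R by rewrite ltr0n.
rewrite /supp_card esum_mkcond.
rewrite (eq_esum (b := fun x => ((0 < profile (path_of s) (@box d M) t x)%R%:R)%:E)); last first.
  move=> x _; rewrite /density -[x \in _]/(x \in [set x | 0 < density t s x]).
  have -> : (x \in [set x | 0 < density t s x]) = (0 < profile (path_of s) (@box d M) t x).
    have eqv : (0 < density t s x) = (0 < profile (path_of s) (@box d M) t x).
      by rewrite /density pmulr_lgt0 ?invr_gt0.
    by apply/idP/idP => [/set_mem|h]; [rewrite /= eqv | apply: mem_set; rewrite /= eqv].
  by case: ifP.
rewrite esum_zsum //; last exact: finsupp_profile_gt0.
rewrite lee_fin; apply: le_trans (profile_support t0 B0 tv_box_spread) _.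
by rewrite lerD2r ler_nat nsites_range.
Qed.

(** The square root of the density is (w - sqrt t) / sqrt N, so N cancels and only the energy of w
    remains. *)
Lemma density_dirichlet :
  N%:R / 2 * fine (dirichlet (fun x => Num.sqrt (density t s x))) <= smooth_energy t s.
Proof.
have nN : 0 < N%:R :> R by rewrite ltr0n.
pose w := clamp (smeared (@box d M) (path_of s)) (#|{ffun 'I_d -> 'I_M}|%:R)^-1 t.
have sq x : Num.sqrt (density t s x) = (w x - Num.sqrt t) / Num.sqrt N%:R.
  rewrite /density sqrtrM ?sqr_ge0 // sqrtr_sqr sqrtrV ?ler0n // ger0_norm //.
  by rewrite subr_ge0; exact: sqrt_le_clamp.
have stepE e x : (Num.sqrt (density t s (x + step_vec e)) - Num.sqrt (density t s x)) ^+ 2 =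
    N%:R^-1 * (w (x + step_vec e) - w x) ^+ 2.
  rewrite !sq -mulrBl exprMn exprVn sqr_sqrtr ?ler0n // mulrC; congr (_ * _ ^+ 2).
  by ring.
have fin e : finsupp (fun x => (Num.sqrt (density t s (x + step_vec e)) -
    Num.sqrt (density t s x)) ^+ 2).
  apply: (finsupp_dom (finsupp_clamp_step (smeared (@box d M) (path_of s))
    (#|{ffun 'I_d -> 'I_M}|%:R)^-1 t0 (step_vec e))).
  by move=> x h; rewrite stepE h mulr0.
have := dirichlet_le fin.
have D0 : (0 <= dirichlet (fun x => Num.sqrt (density t s x)))%E.
  by rewrite mule_ge0 ?lee_fin ?invr_ge0 // esum_ge0 // => p _; rewrite lee_fin sqr_ge0.
move=> h.
have hf : dirichlet (fun x => Num.sqrt (density t s x)) \is a fin_num.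
  by rewrite ge0_fin_numE // (le_lt_trans h) // ltry.
move: h; rewrite -{1}(fineK hf) lee_fin => h.
apply: le_trans (ler_wpM2l (_ : 0 <= N%:R / 2) h) _; first by rewrite divr_ge0.
rewrite /smooth_energy /energy card_ord le_eqVlt; apply/orP; left; apply/eqP.
rewrite (eq_bigr (fun e => N%:R^-1 * zsum (fun x => (w (x + step_vec e) - w x) ^+ 2))); last first.
  by move=> e _; rewrite -zsumMl; apply: eq_zsum => x; rewrite stepE.
rewrite -mulr_sumr -/w; field.
by rewrite !pnatr_eq0 -!lt0n N0 d0.
Qed.

Lemma density_rate n : (0 < n)%N ->
  (rate n N (density t s) <= ((range_card s)%:R + spread / t + smooth_energy t s)%:E)%E.
Proof.
move=> n0; rewrite EFinD; apply: leeD; first exact: density_supp.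
rewrite lee_fin; apply: le_trans density_dirichlet.
set D := fine _; set a := n%:R `^ _; set e := n%:R `^ _.
have D0 : 0 <= D.
  apply/fine_ge0; rewrite mule_ge0 ?lee_fin ?invr_ge0 // esum_ge0 // => p _.
  by rewrite lee_fin sqr_ge0.
have a0 : 0 <= a <= 1.
  rewrite powR_ge0 /= /a powRN invf_le1 ?powR_gt0 ?ltr0n //.
  by rewrite -[leLHS](powRr0 n%:R); apply: ler_powR; rewrite ?ler1n // divr_ge0.
have e0 : 0 <= e by exact: powR_ge0.
have m2 : Num.max (Num.sqrt D - e) 0 ^+ 2 <= D.
  rewrite -[leRHS](sqr_sqrtr D0) lerXn2r ?nnegrE ?le_max ?lexx ?orbT ?sqrtr_ge0 //.
  by rewrite ge_max sqrtr_ge0 andbT gerBl.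
rewrite -mulrA ler_wpM2l ?divr_ge0 //; case/andP: a0 => a0 a1.
apply: le_trans m2; rewrite ler_piMl ?sqr_ge0 //; lra.
Qed.
End WalkProfile.

(** * The bound with all parameters free *)

(** On a good walk with f_N in F the density is admissible, so the infimum is at most range +
    Delta/t + smooth energy. Hence e^(-range) is at most e^(Delta/t - inf) times the exponential of
    the smooth energy, whose moment is known. Bad walks go into [A]. *)
Lemma nonasymptotic_bound (R : realType) (d n N M Q1 Q : nat) (F : set (Zd d -> R))
    (t l Kp lam c vmax eta A E2 : R) :
  (0 < d)%N -> (0 < n)%N -> (0 < N)%N -> (0 < M)%N -> (0 < Q)%N ->
  1 <= t -> 0 < l -> 0 < lam <= 1 -> 0 < c ->
  let Delta := @spread R d N M l Kp Q1%:R in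
  let B : R := (M ^ d)%:R in
  (Delta + lam * N%:R + t / lam * Q1%:R) / N%:R <= n%:R `^ (- (1 / 16)) ->
  c / B <= 2^-1 -> ln N%:R <= vmax -> vmax * (Q1%:R + Delta / t) <= c * Q%:R ->
  2 * c * vmax * (2 / M%:R) / B <= eta -> eta <= 2^-1 ->
  expR (- Q1%:R) + expR (- Kp) *
    (((((2 * N + M).+1 ^ d) * N.+1) ^ Q1)%:R * (Q1 * N).+1%:R) <= A ->
  expR (Delta / t + 2 * eta * N%:R + c * Q%:R / B) *
    ((((2 * N + M).+1 ^ d).+1) ^ Q)%:R <= expR E2 ->
  ((Eexp_range N F)%:E <=
    A%:E + expeR (E2%:E - ereal_inf [set rate n N h | h in admissible n N F]))%E.
Proof.
move=> d0 n0 N0 M0 Q0 t1 l0 hlam c0 Delta B hl1 cB hv hQ heta eta2 hA hE2.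
set J := ereal_inf _.
have t0 : 0 < t by apply: lt_le_trans t1.
have nN : 1 <= N%:R :> R by rewrite ler1n.
have vmax0 : 0 <= vmax by apply: le_trans hv; rewrite ln_ge0.
have MB : 0 < B by rewrite ltr0n expn_gt0 M0.
have BE : #|{ffun 'I_d -> 'I_M}|%:R = B :> R by rewrite card_ffun !card_ord.
have B0 : (0 < #|{ffun 'I_d -> 'I_M}|)%N by rewrite card_ffun !card_ord expn_gt0 M0.
have K0 : (0 < #|'I_(2 * d)|)%N by rewrite card_ord muln_gt0.
have eta0 : 0 <= eta.
  by apply: le_trans heta; rewrite !mulr_ge0 ?invr_ge0 // ltW.
pose Z : R := (2 * d)%:R ^+ N.
have Z0 : 0 < Z by rewrite exprn_gt0 // ltr0n muln_gt0.
have cardZ : \sum_(s : walk d N) 1 = Z :> R.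
  by rewrite sumr_const card_ffun !card_ord natrX.
pose good (s : walk d N) := (range_card s <= Q1)%N && (rough_energy s <= Kp :> R).
pose chosen s := good s && `[< F (fN s) >].
have hcod (s : walk d N) (k : 'I_N) : pos s k \in codom (@candidate d M N).
  exact: pos_codom.
(* A range above Q1 is paid by the factor e^(-range) itself; otherwise the rough energy exceeds Kp
   and its exponential moment pays. *)
have first_two : \sum_(s : walk d N | ~~ good s) expR (- (range_card s)%:R) <= Z * A.
  apply: le_trans (ler_wpM2l (ltW Z0) hA); rewrite mulrDr.
  rewrite (bigID (fun s : walk d N => (range_card s <= Q1)%N)) /= addrC lerD //.
    rewrite -cardZ mulr_suml big_mkcond; apply: ler_sum => s _.
    case: ifP => [/andP[_]|_]; last by rewrite mul1r expR_ge0.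
    by rewrite -ltnNge => h; rewrite mul1r ler_expR lerN2 ler_nat ltnW.
  have mom := @rough_energy_moment R _ _ _ (@step_vec d) (@candidate d M N) K0 Q1 N
    [ffun=> ord0] (fun s => (range_card s <= Q1)%N)
    (fun s h => leq_trans (nsites_range s) h)
    hcod.
  apply: (@le_trans _ _ (expR (- Kp) * \sum_(s : walk d N | (range_card s <= Q1)%N)
     expR (rough_energy s))).
    rewrite mulr_sumr [leLHS]big_mkcond [leRHS]big_mkcond; apply: ler_sum => s _.
    rewrite /good; case: (range_card s <= Q1)%N => //=; rewrite ?andbF ?andbT //.
    rewrite -ltNge -expRD; case: ifP => [h|_]; last exact: expR_ge0.
    by rewrite ler_expR; have := ler0n R (range_card s); lra.
  rewrite mulrCA ler_pM2l ?expR_gt0 // mulrCA.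
  have -> : Z = #|'I_(2 * d)|%:R ^+ N by rewrite card_ord.
  have -> : ((2 * N + M).+1 ^ d)%N = #|{: {ffun 'I_d -> 'I_(2 * N + M).+1}}|.
    by rewrite card_ffun !card_ord.
  exact: mom.
(* Above the threshold w / sqrt t <= w because t >= 1, and w^2 = z is at most N, so w <= N. The
   indicator later bounds the total mass of v by vmax times the size of the support. *)
have vle (s : walk d N) x :
    ln (clamp (smeared (@box d M) (path_of s)) (#|{ffun 'I_d -> 'I_M}|%:R)^-1 t x / Num.sqrt t)
    <= vmax * (0 < profile (path_of s) (@box d M) t x)%R%:R.
  have st0 : 0 < Num.sqrt t by rewrite sqrtr_gt0.
  have [[_ [-> ->]]|[_ [ws wz]]] := profile_cases (path_of s) (@box d M) t0 x.
    by rewrite divff ?gt_eqF // ln1 ltxx mulr0.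
  have -> : 0 < profile (path_of s) (@box d M) t x.
    by rewrite exprn_gt0 // subr_gt0.
  rewrite mulr1; set w := clamp _ _ _ _ in ws wz *.
  have w0 : 0 < w by apply: lt_trans ws.
  have st1 : 1 <= Num.sqrt t by rewrite -[leLHS]sqrtr1 ler_wsqrtr.
  apply: le_trans hv; rewrite ler_ln ?posrE ?divr_gt0 //; last exact: lt_le_trans nN.
  rewrite ler_pdivrMr //; apply: (@le_trans _ _ N%:R); last by rewrite ler_peMr.
  have w2 : w ^+ 2 <= N%:R ^+ 2.
    rewrite wz BE mulrC ler_pdivrMr //; apply: (@le_trans _ _ (N%:R * B)).
      by rewrite -BE -natrM ler_nat (leq_trans (max_card _)) // card_prod card_ord.
    by rewrite expr2 ler_wpM2r ?ler_peMr // ltW.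
  by move: w2; rewrite ler_pXn2r // nnegrE ?ler0n // ltW.
have third : (((Z^-1 * \sum_(s | chosen s) expR (- (range_card s)%:R))%:E : \bar R) <=
    expeR (E2%:E - J))%E.
  have [s0 hs0|none] := pickP chosen; last first.
    by rewrite big_pred0 // mulr0; exact: expeR_ge0.
  have adm s : chosen s -> admissible n N F (@density R d N M t s).
    case/andP => /andP[h1 h2] /asboolP hF; split.
      by move=> x; exact: density_ge0.
    split; first exact: density_l1_fin.
    exists (fN s) => //.
    have h1' : (range_card s)%:R <= Q1%:R :> R by rewrite ler_nat.
    apply: le_trans (density_l1_dist d0 N0 M0 t0 l0 h1' h2 hlam) _.
    by rewrite lee_fin.
  have Jle s : chosen s ->
      (J <= ((range_card s)%:R + Delta / t + @smooth_energy R d N M t s)%:E)%E.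
    move=> hs; have /andP[/andP[h1 h2] _] := hs.
    have h1' : (range_card s)%:R <= Q1%:R :> R by rewrite ler_nat.
    apply: le_trans (density_rate d0 N0 M0 t0 l0 h1' h2 n0).
    by apply: ereal_inf_lbound; exists (@density R d N M t s) => //; exact: adm.
  (* If J = -oo the right side is infinite; J = +oo is excluded by the density of [s0]. *)
  case EJ : J => [j| |]; last by rewrite /= leey.
    2: by have := Jle s0 hs0; rewrite EJ.
  rewrite -EFinB /= lee_fin mulrC ler_pdivrMr //.
  apply: (@le_trans _ _ (expR (Delta / t - j) *
      \sum_(s | chosen s) expR (@smooth_energy R d N M t s))).
    rewrite mulr_sumr; apply: ler_sum => s hs; rewrite -expRD ler_expR.
    have := Jle s hs; rewrite EJ lee_fin; lra.
  have hsum s : chosen s ->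
    \sum_g ln (clamp (smeared (@box d M) (path_of s)) (#|{ffun 'I_d -> 'I_M}|%:R)^-1 t
       (@candidate d M N g) / Num.sqrt t) <= c * Q%:R.
    case/andP => /andP[h1 h2] _.
    have h1' : (range_card s)%:R <= Q1%:R :> R by rewrite ler_nat.
    apply: le_trans hQ.
    have supp := profile_support t0 B0 (tv_box_spread d0 l0 h1' h2).
    apply: (@le_trans _ _ (vmax * zsum (fun x => (0 < profile (path_of s) (@box d M) t x)%R%:R))).
      rewrite -zsumMl.
      have ff := finsupp_profile_gt0 (path_of s) (@box d M) t0.
      apply: le_trans (sum_inj_le_zsum (@candidate_inj d M N) (finsuppMl vmax ff) _); last first.
        by move=> x; rewrite mulr_ge0.
      apply: ler_sum => g _.
      exact: vle.
    rewrite ler_wpM2l //; apply: le_trans supp _; rewrite lerD2r.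
    by apply: le_trans h1'; rewrite ler_nat nsites_range.
  have mom := @smooth_energy_moment R (Zd d) _ _ _ (@step_vec d) (@box d M) (@candidate d M N)
    N Q chosen t c (2 / M%:R) vmax eta K0 B0 t0 (@candidate_inj d M N) (@box_inj d M)
    (fun s z => smeared_codom s z) c0 Q0.
  rewrite !BE in mom.
  have hvm (s : walk d N) x : ln (clamp (smeared (@box d M) (path_of s)) B^-1 t x / Num.sqrt t) <= vmax.
    rewrite -BE; apply: le_trans (vle s x) _; rewrite ler_piMr //.
    by case: (0 < profile _ _ _ _).
  rewrite !BE in hsum; have {}mom := mom cB hvm hsum.
  have hb e : B^-1 * zsum (fun z => `|(occ (@box d M) (z - step_vec e))%:R - (occ (@box d M) z)%:R| : R) <= 2 / M%:R.
    by rewrite -BE; exact: box_boundary.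
  have {}mom := mom hb heta; rewrite eta0 eta2 in mom; have {}mom := mom isT.
  rewrite /smooth_energy BE.
  apply: le_trans (ler_wpM2l (expR_ge0 _) mom) _.
  have -> : #|{ffun 'I_d -> 'I_(2 * N + M).+1}| = ((2 * N + M).+1 ^ d)%N.
    by rewrite card_ffun !card_ord.
  rewrite !card_ord -/Z; set X := ((2 * N + M).+1 ^ d)%N.
  have -> : expR (E2 - j) * Z = Z * expR (- j) * expR E2 by rewrite expRD; ring.
  rewrite [leLHS](_ : _ = Z * expR (- j) * (expR (Delta / t + 2 * eta * N%:R +
    c * Q%:R / B) * (X.+1 ^ Q)%:R)); last by rewrite !expRD; ring.
  by rewrite ler_pM2l // mulr_gt0 ?expR_gt0.
rewrite /Eexp_range -/Z.
apply: (@le_trans _ _ (A + Z^-1 * \sum_(s | chosen s) expR (- (range_card s)%:R))%:E).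
  rewrite lee_fin -[X in X + _](mulKf (lt0r_neq0 Z0)) -mulrDr ler_pM2l ?invr_gt0 //.
  apply: (@le_trans _ _ (\sum_(s : walk d N | ~~ good s) expR (- (range_card s)%:R) +
     \sum_(s | chosen s) expR (- (range_card s)%:R))); last by rewrite lerD2r.
  rewrite [X in _ <= X + _]big_mkcond [X in _ <= _ + X]big_mkcond -big_split /=.
  apply: ler_sum => s _; rewrite /chosen; case: (good s) => /=.
    by rewrite add0r; case: asboolP => _; rewrite ?mulr1 ?mulr0.
  by rewrite addr0; case: asboolP => _; rewrite ?mulr1 ?mulr0 ?expR_ge0.
by rewrite EFinD leeD2l.
Qed.

(** * Estimates in powers of the scale s *)

Section Asymptotics.
Context {R : realType}.
Implicit Types s D E kappa : R.

Lemma expR1_ge2 : 2 <= expR 1 :> R.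
Proof. by apply: le_trans (expR_ge1Dx _); rewrite -natr1. Qed.

Lemma exprn_ege (s : R) (a b : nat) : 1 <= s -> (a <= b)%N -> s ^+ a <= s ^+ b.
Proof. by move=> s1 ab; rewrite ler_weXn2l. Qed.

(** Logarithms of powers of n are absorbed by s = y^2: the crude bound ln y <= y yields only a
    multiple of y, which the square dominates without a constant. *)
Lemma ln_le_sqr (y : R) (k : nat) : 2 * k%:R + 3 <= y ->
  ln (4 * (y ^+ 2) ^+ k) <= y ^+ 2.
Proof.
move=> hy; have k0 : 0 <= k%:R :> R by rewrite ler0n.
have y0 : 0 < y by lra.
rewrite lnM ?posrE ?exprn_gt0 // -exprM lnXn //.
have l4 : ln 4 <= 3 :> R by have := @le_ln1Dx R 3 ltac:(lra); rewrite (_ : 1 + 3 = 4) //; ring.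
have ly : ln y <= y by have := @ln_sublinear R y y0; lra.
have : ln y *+ (2 * k) <= y *+ (2 * k) by rewrite lerMn2r ly orbT.
rewrite -[y *+ _]mulr_natl natrM => h.
apply: le_trans (lerD l4 h) _; rewrite expr2; nra.
Qed.

(** The weight l = s^96 makes the energy term D s^98 and the mass term D s^96 comparable;
    multiplying by M <= s^64 gives the exponent 162. *)
Lemma spread_bound (d M N Q1 : nat) kappa D s :
  1 <= s -> 1 <= D -> 0 <= kappa -> M%:R <= s ^+ 64 -> N%:R = D * s ^+ 192 ->
  Q1%:R <= 3 * kappa * D ->
  @spread R d N M (s ^+ 96) (D * s ^+ 2) Q1%:R <=
  d%:R * (2 * d%:R + 4 + 6 * kappa) * D * s ^+ 162.
Proof.
move=> s1 D1 k0 hM hN hQ; rewrite /spread hN.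
have s0 : 0 < s by lra.
have d0 : 0 <= d%:R :> R by rewrite ler0n.
have p n : 0 < s ^+ n by rewrite exprn_gt0.
have e1 : 4 / s ^+ 96 * (D * s ^+ 192) = 4 * D * s ^+ 96.
  by rewrite (_ : 192 = 96 + 96)%N // exprD; field; rewrite gt_eqF.
have e2 : s ^+ 96 / 2 * (2 * (2 * d)%:R * (D * s ^+ 2)) = 2 * d%:R * D * s ^+ 98.
  by rewrite (_ : 98 = 96 + 2)%N // exprD natrM; field.
rewrite e1 e2 (_ : 162 = 64 + 98)%N // exprD.
rewrite [leRHS](_ : _ = d%:R * s ^+ 64 * ((2 * d%:R + 4 + 6 * kappa) * D * s ^+ 98)); last by ring.
apply: ler_pM.
- by rewrite mulr_ge0.
- have D0 : 0 <= D := le_trans ler01 D1.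
  apply: addr_ge0; last by rewrite mulr_ge0.
  by apply: addr_ge0; (apply: mulr_ge0; last exact: ltW); do ?apply: mulr_ge0.
- by rewrite ler_wpM2l.
have h1 : 4 * D * s ^+ 96 <= 4 * D * s ^+ 98.
  by rewrite ler_wpM2l ?exprn_ege // mulr_ge0 //; lra.
have h2 : 2 * Q1%:R <= 6 * kappa * D * s ^+ 98.
  apply: (@le_trans _ _ (6 * kappa * D)); first lra.
  by rewrite ler_peMr ?exprn_ege1 // !mulr_ge0 //; lra.
lra.
Qed.

(** The cap D s^2 beats the entropy, at most 3 kappa (d + 3) D s. Both events then cost e^(-2 kappa
    D), and the spare e^(-kappa D) absorbs the factor 2. *)
Lemma rare_event_bound (d N X Q1 : nat) kappa D s :
  1 <= s -> 1 <= D -> 1 <= kappa -> (N < X)%N -> X%:R <= expR s ->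
  2 * kappa * D <= Q1%:R <= 3 * kappa * D -> (0 < Q1)%N ->
  3 * kappa * (d%:R + 3) + 2 * kappa <= s ->
  expR (- Q1%:R) + expR (- (D * s ^+ 2)) *
    (((X ^ d * N.+1) ^ Q1)%:R * (Q1 * N).+1%:R) <= expR (- (kappa * D)).
Proof.
move=> s1 D1 k1 NX hX /andP[q1 q2] Q0 hs.
have kD : 1 <= kappa * D by nra.
have d0 : 0 <= d%:R :> R by rewrite ler0n.
have half : 2 * expR (- (2 * kappa * D)) <= expR (- (kappa * D)).
  have -> : - (2 * kappa * D) = - (kappa * D) + - (kappa * D) by ring.
  rewrite expRD mulrA ler_piMl ?expR_ge0 // expRN ler_pdivrMr ?expR_gt0 // mul1r.
  by apply: le_trans expR1_ge2 _; rewrite ler_expR.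
have h1 : expR (- Q1%:R) <= expR (- (2 * kappa * D)) by rewrite ler_expR; lra.
have Q1' : 1 <= Q1%:R :> R by rewrite ler1n.
have NX' : N.+1%:R <= expR s by apply: le_trans hX; rewrite ler_nat.
have c1 : ((X ^ d * N.+1) ^ Q1)%:R <= expR (Q1%:R * ((d%:R + 1) * s)).
  rewrite natrX mulrC expRM_natr lerXn2r ?nnegrE ?expR_ge0 //.
  rewrite mulrDl mul1r expRD natrM natrX ler_pM ?exprn_ge0 //.
  by rewrite mulrC expRM_natr lerXn2r ?nnegrE ?expR_ge0.
have c2 : (Q1 * N).+1%:R <= expR (Q1%:R + s).
  rewrite expRD; apply: (@le_trans _ _ ((Q1.+1 * N.+1)%:R)).
    by rewrite ler_nat mulSn mulnS addSn ltnS addnA leq_addl.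
  rewrite natrM ler_pM // -natr1 addrC; exact: expR_ge1Dx.
have h2 : expR (- (D * s ^+ 2)) * (((X ^ d * N.+1) ^ Q1)%:R * (Q1 * N).+1%:R) <=
    expR (- (2 * kappa * D)).
  apply: le_trans (ler_wpM2l (expR_ge0 _) (ler_pM _ _ c1 c2)) _ => //.
  rewrite -!expRD ler_expR.
  have a1 : Q1%:R + s <= 2 * (Q1%:R * s) by nra.
  have a2 : Q1%:R * ((d%:R + 1) * s) + (Q1%:R + s) <= Q1%:R * ((d%:R + 3) * s) by nra.
  have a3 : Q1%:R * ((d%:R + 3) * s) <= 3 * kappa * D * ((d%:R + 3) * s).
    by rewrite ler_wpM2r // mulr_ge0 //; lra.
  have a4 : D * s * (3 * kappa * (d%:R + 3) + 2 * kappa) <= D * s * s.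
    by rewrite ler_wpM2l // mulr_ge0 //; lra.
  have a5 : 2 * kappa * D <= 2 * kappa * D * s by rewrite ler_peMr // !mulr_ge0 //; lra.
  rewrite expr2; lra.
lra.
Qed.

(** The dimension d >= 3 enters through M^d >= M^3. *)
Lemma box_volume_ge (d M : nat) s : (3 <= d)%N -> 0 < s -> (0 < M)%N ->
  s ^+ 64 / 2 <= M%:R -> s ^+ 192 / 8 <= (M ^ d)%:R.
Proof.
move=> d3 s0 M0 hM; apply: (@le_trans _ _ (M ^ 3)%:R); last first.
  by rewrite ler_nat leq_pexp2l.
rewrite natrX (_ : s ^+ 192 / 8 = (s ^+ 64 / 2) ^+ 3); last first.
  by rewrite (_ : 192 = 64 * 3)%N // exprM; field.
by rewrite lerXn2r ?nnegrE // divr_ge0 // ltW // exprn_gt0.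
Qed.

(** The exponent 240 is 64 + 192 - 16: one power each from 1/M and 1/M^d, against c vmax = c2
    s^16. *)
Lemma sampling_rate_bounds (d M : nat) c2 s :
  (3 <= d)%N -> 1 <= s -> (0 < M)%N -> 0 <= c2 -> s ^+ 64 / 2 <= M%:R -> 128 * c2 <= s ->
  [/\ c2 * s ^+ 15 / (M ^ d)%:R <= 2^-1,
      2 * (c2 * s ^+ 15) * s * (2 / M%:R) / (M ^ d)%:R <= 64 * c2 / s ^+ 240 &
      64 * c2 / s ^+ 240 <= 2^-1].
Proof.
move=> d3 s1 M0 c20 hM cs.
have s0 : 0 < s by lra.
have p n : 0 < s ^+ n by rewrite exprn_gt0.
have hB := box_volume_ge d3 s0 M0 hM.
have B0 : 0 < (M ^ d)%:R :> R by rewrite ltr0n expn_gt0 M0.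
have nM : 0 < M%:R :> R by rewrite ltr0n.
split.
- rewrite ler_pdivrMr //; apply: le_trans (ler_wpM2l _ hB) => //.
  have : 128 * c2 * s ^+ 15 <= s ^+ 192.
    apply: (@le_trans _ _ (s * s ^+ 15)); first by rewrite ler_pM2r.
    by rewrite -exprS exprn_ege.
  have := p 192%N; lra.
- rewrite [leLHS](_ : _ = 2 * (c2 * s ^+ 15) * s * 2 / (M%:R * (M ^ d)%:R)); last first.
    by rewrite invfM; ring.
  rewrite ler_pdivrMr ?mulr_gt0 //.
  have e : 2 * (c2 * s ^+ 15) * s * 2 = 64 * c2 / s ^+ 240 * (s ^+ 64 / 2 * (s ^+ 192 / 8)).
    rewrite (_ : 240 = 64 + 176)%N // (_ : 192 = 15 + 1 + 176)%N // !exprD expr1; field.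
    by rewrite !gt_eqF.
  rewrite e; apply: ler_wpM2l.
    by apply: divr_ge0; [exact: mulr_ge0 | exact: ltW].
  by apply: ler_pM => //; apply: divr_ge0 => //; exact: ltW.
- rewrite ler_pdivrMr //; apply: (@le_trans _ _ (s / 2)); first lra.
  by rewrite mulrC ler_pM2l ?invr_gt0 // -[leLHS]expr1 exprn_ege.
Qed.

(** The split parameter s^(-8) balances the two threshold errors: its product with N and its
    quotient into t D are both D s^184, below the allowed D s^186. *)
Lemma profile_error_bound (N Q1 : nat) kappa D s c1 Delta :
  1 <= s -> 1 <= D -> 0 <= kappa -> 0 <= c1 -> Delta <= c1 * D * s ^+ 162 ->
  N%:R = D * s ^+ 192 -> Q1%:R <= 3 * kappa * D -> c1 + 1 + 3 * kappa <= s ->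
  (Delta + (s ^+ 8)^-1 * N%:R + s ^+ 176 / (s ^+ 8)^-1 * Q1%:R) / N%:R <= (s ^+ 6)^-1.
Proof.
move=> s1 D1 k0 c10 hD hN hQ hs.
have s0 : 0 < s by lra.
have p n : 0 < s ^+ n by rewrite exprn_gt0.
have D0 : 0 < D by lra.
rewrite hN ler_pdivrMr ?mulr_gt0 // invrK.
have e0 : (s ^+ 8)^-1 * (D * s ^+ 192) = D * s ^+ 184.
  by rewrite (_ : 192 = 8 + 184)%N // exprD; field; rewrite gt_eqF.
have e1 : (s ^+ 6)^-1 * (D * s ^+ 192) = D * s ^+ 184 * s * s.
  by rewrite (_ : 192 = 6 + (184 + 1 + 1))%N // !exprD expr1; field; rewrite gt_eqF.
rewrite e0 e1 -exprD.
have h1 : c1 * D * s ^+ 162 <= c1 * D * s ^+ 184.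
  by rewrite ler_wpM2l ?exprn_ege // mulr_ge0 // ltW.
have h2 : s ^+ 184 * Q1%:R <= s ^+ 184 * (3 * kappa * D) by rewrite ler_pM2l.
have Ds : 0 < D * s ^+ 184 by rewrite mulr_gt0.
have h3 : D * s ^+ 184 * (c1 + 1 + 3 * kappa) <= D * s ^+ 184 * s by rewrite ler_pM2l.
have h4 : D * s ^+ 184 * s <= D * s ^+ 184 * s * s.
  by rewrite ler_peMr // mulr_ge0 // ltW.
rewrite (_ : (176 + 8)%N = 184%N) //; lra.
Qed.

Lemma spread_ratio c1 E s Delta : 0 < s ->
  Delta <= c1 * (E * s ^+ 14) * s ^+ 162 -> Delta / s ^+ 176 <= c1 * E.
Proof.
move=> s0; rewrite ler_pdivrMr ?exprn_gt0 //.
have -> : c1 * (E * s ^+ 14) * s ^+ 162 = c1 * E * s ^+ 176; last by [].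
by rewrite (_ : 176 = 14 + 162)%N // exprD; ring.
Qed.

(** Origin of the height c = c2 s^15 of a sampled mass: v is at most s on O(E s^14) sites, and Q is
    at least E. *)
Lemma candidate_mass_bound (Q Q1 : nat) kappa E s c1 Delta :
  1 <= s -> 1 <= E -> 0 <= kappa -> 0 <= c1 -> Delta <= c1 * (E * s ^+ 14) * s ^+ 162 ->
  Q1%:R <= 3 * kappa * (E * s ^+ 14) -> E <= Q%:R ->
  s * (Q1%:R + Delta / s ^+ 176) <= (3 * kappa + c1) * s ^+ 15 * Q%:R.
Proof.
move=> s1 E1 k0 c10 hD hQ1 hQ.
have s0 : 0 < s by lra.
have p n : 0 < s ^+ n by rewrite exprn_gt0.
have h1 : Delta / s ^+ 176 <= c1 * E.
  exact: spread_ratio.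
have h2 : c1 * E <= c1 * E * s ^+ 14 by rewrite ler_peMr ?exprn_ege1 // mulr_ge0 //; lra.
apply: (@le_trans _ _ (s * ((3 * kappa + c1) * (E * s ^+ 14)))).
  by rewrite ler_pM2l //; lra.
rewrite (_ : s * _ = (3 * kappa + c1) * s ^+ 15 * E); last by rewrite (exprS s 14); ring.
by rewrite ler_wpM2l // mulr_ge0 ?(ltW (p _)) //; lra.
Qed.

(** The three exponents are at most c1 E, 128 c2 E and 16 c2 E, and the entropy at most 2 (d + 1) E
    s, so E s^2 dominates. *)
Lemma smooth_event_bound (d M N X Q : nat) E s c1 c2 Delta :
  (3 <= d)%N -> 1 <= s -> (0 < M)%N -> 1 <= E -> 0 <= c1 -> 0 <= c2 -> (1 < X)%N ->
  s ^+ 64 / 2 <= M%:R -> Delta <= c1 * (E * s ^+ 14) * s ^+ 162 ->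
  N%:R = E * s ^+ 14 * s ^+ 192 -> X%:R <= expR s -> Q%:R <= 2 * E ->
  c1 + 144 * c2 + 2 * (d%:R + 1) <= s ->
  expR (Delta / s ^+ 176 + 2 * (64 * c2 / s ^+ 240) * N%:R + c2 * s ^+ 15 * Q%:R / (M ^ d)%:R) *
    (((X ^ d).+1) ^ Q)%:R <= expR (E * s ^+ 2).
Proof.
move=> d3 s1 M0 E1 c10 c20 X1 hM hD hN hX hQ hs.
have s0 : 0 < s by lra.
have p n : 0 < s ^+ n by rewrite exprn_gt0.
have hB := box_volume_ge d3 s0 M0 hM.
have B0 : 0 < (M ^ d)%:R :> R by rewrite ltr0n expn_gt0 M0.
have E0 : 0 < E by lra.
have d0 : 0 <= d%:R :> R by rewrite ler0n.
have h1 : Delta / s ^+ 176 <= c1 * E.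
  exact: spread_ratio.
have h2 : 2 * (64 * c2 / s ^+ 240) * N%:R <= 128 * c2 * E.
  have -> : 2 * (64 * c2 / s ^+ 240) * N%:R = 128 * c2 * E / s ^+ 34.
    rewrite hN (_ : 240 = 14 + 192 + 34)%N // !exprD; field.
    by rewrite !gt_eqF.
  rewrite ler_pdivrMr // ler_peMr ?exprn_ege1 // !mulr_ge0 // ltW //.
have h3 : c2 * s ^+ 15 * Q%:R / (M ^ d)%:R <= 16 * c2 * E.
  rewrite ler_pdivrMr //.
  apply: (@le_trans _ _ (16 * c2 * E * (s ^+ 192 / 8))); last first.
    by rewrite ler_wpM2l // !mulr_ge0 // ltW.
  apply: (@le_trans _ _ (c2 * s ^+ 15 * (2 * E))).
    by rewrite ler_wpM2l // mulr_ge0 // ltW.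
  have : c2 * E * s ^+ 15 <= c2 * E * s ^+ 192.
    by rewrite ler_wpM2l ?exprn_ege // mulr_ge0 // ltW.
  lra.
have h4 : (((X ^ d).+1) ^ Q)%:R <= expR (Q%:R * ((d%:R + 1) * s)).
  rewrite natrX mulrC expRM_natr lerXn2r ?nnegrE ?expR_ge0 //.
  apply: (@le_trans _ _ (X ^ d.+1)%:R).
    rewrite ler_nat expnS; apply: (@leq_trans (2 * X ^ d)); last by rewrite leq_mul2r X1 orbT.
    by rewrite mul2n -addnn -addn1 leq_add2l expn_gt0 (ltnW X1).
  rewrite natrX mulrC natr1 expRM_natr lerXn2r ?nnegrE ?expR_ge0 //.
apply: le_trans (ler_wpM2l (expR_ge0 _) h4) _; rewrite -expRD ler_expR.
have h5 : Q%:R * ((d%:R + 1) * s) <= 2 * E * ((d%:R + 1) * s).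
  by rewrite ler_wpM2r // mulr_ge0 //; lra.
have h6 : E * (c1 + 144 * c2) <= E * (c1 + 144 * c2) * s.
  by rewrite ler_peMr // mulr_ge0 //; lra.
have h7 : E * s * (c1 + 144 * c2 + 2 * (d%:R + 1)) <= E * s * s by rewrite ler_pM2l // mulr_gt0.
rewrite expr2; lra.
Qed.
End Asymptotics.

(** * Fractional powers of n and integer rounding *)

Section Roots.
Context {R : realType}.

Lemma powR_root (n k : nat) (a : R) : a = k%:R / 192 ->
  n%:R `^ a = (n%:R `^ (1 / 192)) ^+ k.
Proof.
move=> ->; rewrite -powR_mulrn ?powR_ge0 // -powRrM; congr (_ `^ _); by rewrite mul1r mulrC.
Qed.

Lemma nat_above (x : R) : 0 <= x -> exists m : nat, x <= m.+1%:R <= x + 1.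
Proof.
move=> x0; exists (Num.truncn x); have /andP[h1 h2] := truncn_itv x0.
by rewrite ltW //= -natr1 lerD2r.
Qed.

Lemma nat_below (x : R) : 2 <= x -> exists m : nat, [/\ (0 < m)%N, x / 2 <= m%:R & m%:R <= x].
Proof.
move=> x2; exists (Num.truncn x); have /andP[h1 h2] := truncn_itv (ltac:(lra) : 0 <= x).
have h3 : x / 2 <= (Num.truncn x)%:R by move: h2; rewrite -natr1; lra.
by split=> //; rewrite -(ltr0n R); apply: lt_le_trans h3; lra.
Qed.
End Roots.

Theorem theorem2p2 (R : realType) (d : nat) (hd : (3 <= d)%N)
  (F : set (Zd d -> R)) (hF : forall f, F f -> forall x, 0 <= f x)
  (kappa : R) (hk : 1 <= kappa) :
  exists n0 : nat, forall n : nat, (n0 <= n)%N ->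
    let N := (n ^ (d + 2))%N in
    ((Eexp_range N F)%:E <=
      (expR (- (kappa * n%:R ^+ d)))%:E +
      expeR ((n%:R `^ (d%:R - 1 / 8))%:E -
             ereal_inf [set rate n N h | h in admissible n N F]))%E.
Proof.
have k0 : 0 <= kappa := le_trans ler01 hk.
have d0 : 0 <= d%:R :> R by rewrite ler0n.
pose c1 : R := d%:R * (2 * d%:R + 4 + 6 * kappa).
pose c2 : R := 3 * kappa + c1.
have c10 : 0 <= c1 by rewrite /c1 mulr_ge0 //; lra.
have c20 : 0 <= c2 by rewrite /c2; lra.
pose C1 : R := 3 * kappa * (d%:R + 3) + 2 * kappa.
pose C2 : R := c1 + 144 * c2 + 2 * (d%:R + 1).
pose C3 : R := 2 * (96 * (d + 2))%:R + 3.
have C10 : 0 <= C1 by rewrite /C1 addr_ge0 // !mulr_ge0 //; lra.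
have C20 : 0 <= C2 by rewrite /C2; lra.
have C30 : 0 <= C3 by rewrite /C3 addr_ge0 // mulr_ge0.
(* [C3] is a lower bound required of y, the other summands of s. Taking n >= S0^192 gives y >= S0,
   and s = y^2 >= y. *)
pose S0 : R := C1 + C2 + 128 * c2 + (c1 + 1 + 3 * kappa) + C3 + 2.
have S02 : 2 <= S0 by rewrite /S0; lra.
(* Scales: with s = n^(1/96), D = n^d and N = D s^192, take M ~ s^64, t = s^176,
   about 2 kappa D visited sites, and E = D s^(-14) sampled points; each error
   term is then O(E s) while the allowed error n^(d - 1/8) is E s^2. *)
have [m /andP[hm _]] := nat_above (exprn_ge0 192 (ltac:(lra) : 0 <= S0)).
exists m.+1 => n hn; cbv zeta; set N := (n ^ (d + 2))%N.
have n0 : (0 < n)%N := leq_trans (ltn0Sn m) hn.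
set y : R := n%:R `^ (1 / 192).
have y0 : 0 <= y by apply: powR_ge0.
have yn : y ^+ 192 = n%:R.
  rewrite -(@powR_root R n 192 1) ?powRr1 // divff //.
have hy : S0 <= y.
  rewrite -(@ler_pXn2r _ 192) ?nnegrE //; last by lra.
  by rewrite yn; apply: le_trans hm _; rewrite ler_nat.
set s : R := y ^+ 2.
have ys : y <= s by rewrite /s expr2 ler_peMr //; lra.
have hs : S0 <= s by apply: le_trans ys.
have s1 : 1 <= s by lra.
have s0 : 0 < s by lra.
have p k : 0 < s ^+ k by rewrite exprn_gt0.
have sn : s ^+ 96 = n%:R by rewrite -exprM.
pose D : R := n%:R ^+ d.
have DE : D = s ^+ (96 * d) by rewrite /D -sn exprM.
pose E : R := D / s ^+ 14.
have ED : D = E * s ^+ 14 by rewrite /E divfK // gt_eqF.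
have E1 : 1 <= E.
  rewrite ler_pdivlMr // mul1r DE exprn_ege //.
  by apply: (@leq_trans (96 * 1)) => //; rewrite leq_mul2l /= (leq_trans _ hd).
have D1 : 1 <= D by rewrite DE exprn_ege1.
have NE : N%:R = D * s ^+ 192.
  by rewrite /N natrX exprD -/D -sn -exprM.
have [M [M0 hM1 hM2]] : exists m : nat, [/\ (0 < m)%N, s ^+ 64 / 2 <= m%:R & m%:R <= s ^+ 64].
  apply: nat_below; apply: (@le_trans _ _ (s ^+ 1)); first by rewrite expr1; lra.
  exact: exprn_ege.
have kD : 1 <= kappa * D by nra.
have [q1 /andP[hq1 hq2]] := nat_above (ltac:(nra) : 0 <= 2 * kappa * D).
have [q /andP[hq3 hq4]] := nat_above (le_trans ler01 E1).
have hQ1 : q1.+1%:R <= 3 * kappa * D by lra.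
have hQ : q.+1%:R <= 2 * E by lra.
set X := (2 * N + M).+1.
have N1 : 1 <= N%:R :> R by rewrite NE; apply: mulr_ege1 => //; exact: exprn_ege1.
have N0 : (0 < N)%N by rewrite -(ler1n R).
have NX : (N < X)%N by rewrite /X ltnS mul2n -addnn -addnA leq_addr.
have X1 : (1 < X)%N := leq_ltn_trans N0 NX.
have MN : M%:R <= N%:R :> R.
  apply: le_trans hM2 _; rewrite NE; apply: (@le_trans _ _ (s ^+ 192)).
    exact: exprn_ege.
  by rewrite ler_peMl // ltW.
have X4 : X%:R <= 4 * (y ^+ 2) ^+ (96 * (d + 2)).
  have <- : N%:R = (y ^+ 2) ^+ (96 * (d + 2)) by rewrite exprM -/s sn /N natrX.
  by rewrite /X -natr1 natrD natrM; lra.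
have X0 : 0 < X%:R :> R by rewrite ltr0n.
have lnX : ln X%:R <= s.
  apply: le_trans (@ln_le_sqr R y (96 * (d + 2)) _); last by move: hy; rewrite /S0 /C3; lra.
  by rewrite ler_ln // posrE; apply: lt_le_trans X4.
have hX : X%:R <= expR s by rewrite -[leLHS]lnK ?posrE // ler_expR.
have lnN : ln N%:R <= s.
  by apply: le_trans lnX; rewrite ler_ln ?posrE ?ltr0n // ler_nat ltnW.
have hspread := spread_bound d s1 D1 k0 hM2 NE hQ1.
rewrite -/c1 in hspread.
have hspreadE : @spread R d N M (s ^+ 96) (D * s ^+ 2) q1.+1%:R <=
    c1 * (E * s ^+ 14) * s ^+ 162 by rewrite -ED.
have C1s : C1 <= s by move: hs; rewrite /S0; lra.
have C2s : C2 <= s by move: hs; rewrite /S0; lra.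
have c2s : 128 * c2 <= s by move: hs; rewrite /S0; lra.
have c1s : c1 + 1 + 3 * kappa <= s by move: hs; rewrite /S0; lra.
have [r1 r2 r3] := sampling_rate_bounds hd s1 M0 c20 hM1 c2s.
have NEE : N%:R = E * s ^+ 14 * s ^+ 192 by rewrite -ED.
have hQ1E : q1.+1%:R <= 3 * kappa * (E * s ^+ 14) by rewrite -ED.
(* As 1/8 = 24/192 and s = y^2, the left side is D s^(-12), and D = E s^14. *)
have -> : n%:R `^ (d%:R - 1 / 8) = E * s ^+ 2.
  have nz : n%:R != 0 :> R by rewrite pnatr_eq0 -lt0n.
  rewrite powRD; last by rewrite nz implybT.
  rewrite powR_mulrn ?ler0n // powRN (@powR_root R n 24 (1 / 8)); last by field.
  rewrite -/y -/D ED (_ : 24 = 2 * 12)%N // exprM -/s (_ : 14 = 2 + 12)%N // exprD.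
  by field; rewrite gt_eqF.
apply: (@nonasymptotic_bound R d n N M q1.+1 q.+1 F (s ^+ 176) (s ^+ 96) (D * s ^+ 2)
  (s ^+ 8)^-1 (c2 * s ^+ 15) s (64 * c2 / s ^+ 240)) => //.
- exact: leq_trans (ltn0Sn 2) hd.
- exact: exprn_ege1.
- by rewrite invr_gt0 p /= invf_le1 // exprn_ege1.
- by rewrite mulr_gt0 //; rewrite /c2; lra.
- rewrite powRN (@powR_root R n 12 (1 / 16)); last by field.
  rewrite -/y (_ : 12 = 2 * 6)%N // exprM -/s.
  exact: (profile_error_bound s1 D1 k0 c10 hspread NE hQ1 c1s).
- exact: (candidate_mass_bound s1 E1 k0 c10 hspreadE hQ1E hq3).
- apply: (rare_event_bound (d := d) s1 D1 hk NX hX _ _ C1s) => //.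
  by rewrite hq1 hQ1.
- exact: (smooth_event_bound hd s1 M0 E1 c10 c20 X1 hM1 hspreadE NEE hX hQ C2s).
Qed.
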